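(* For quasi-all functions $f\in\mathcal C(\mathbb T)$, $\dim_{\mathcal H}\big(F(1,f)\big)=1$.
   Context: $\mathbb T=\mathbb R/\mathbb Z$, and $\mathcal C(\mathbb T)$ is the space of continuous functions on $\mathbb T$ with the norm $\|\cdot\|_\infty$. For $k\in\mathbb Z$, $e_k(t)=e^{2\pi i k t}$; for $g\in L^1(\mathbb T)$ and an integer $n\ge 0$, $S_ng(t)=\sum_{k=-n}^n\langle g,e_k\rangle e_k(t)$, where $\langle g,e_k\rangle=\int_{\mathbb T} g\,\overline{e_k}$, is the $n$-th partial sum of the Fourier series of $g$. For $\beta\in[0,1]$ and $f\in\mathcal C(\mathbb T)$, $$F(\beta,f)=\left\{x\in\mathbb T:\ \limsup_{n\to+\infty}\frac{\log|S_nf(x)|}{\log\log n}=\beta\right\},$$ with the convention $\log 0=-\infty$. $\dim_{\mathcal H}$ denotes Hausdorff dimension. ''For quasi-all functions $f\in\mathcal C(\mathbb T)$'' means: for all $f$ in some residual subset (one containing a countable intersection of dense open sets) of $\mathcal C(\mathbb T)$. *)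

(* Defs.v *)
From HB Require Import structures.
From mathcomp Require Import all_boot all_order all_algebra archimedean.
From mathcomp Require Import generic_quotient ring_quotient.
From mathcomp Require Import all_classical all_reals all_analysis.
From mathcomp Require Import complex ring lra.
Set Implicit Arguments.
Unset Strict Implicit.
Unset Printing Implicit Defensive.
Import Order.TTheory GRing.Theory Num.Theory.
Import numFieldNormedType.Exports.
Import Normc.
Local Open Scope classical_set_scope.
Local Open Scope ring_scope.
Local Open Scope quotient_scope.

Definition integers (R : realType) : {pred R} := fun x => x \is a Num.int.
Arguments integers : clear implicits.

Fact integers_zmod_closed (R : realType) : zmod_closed (integers R).
Proof. by split=> [|x y]; [exact: rpred0 | exact: rpredB]. Qed.

HB.instance Definition _ (R : realType) :=
  GRing.isZmodClosed.Build R (integers R) (integers_zmod_closed R).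

Definition circle (R : realType) : Type := Quotient.quot (integers R).

HB.instance Definition _ (R : realType) :=
  Choice.copy (circle R) (Quotient.quot (integers R)).
HB.instance Definition _ (R : realType) :=
  GRing.Zmodule.copy (circle R) (Quotient.quot (integers R)).
HB.instance Definition _ (R : realType) :=
  Quotient.copy (circle R) (Quotient.quot (integers R)).

Section circle_metric.
Variable R : realType.
Implicit Types (x y z : R) (p q r : circle R).

Lemma eq_pi_circle x y : \pi_(circle R) x = \pi y <-> x - y \is a Num.int.
Proof.
have E : (x - y \in integers R) = (\pi_(circle R) x == \pi y).
  exact: Quotient.idealrBE.
split; first by move=> /eqP; rewrite -E.
by move=> h; apply/eqP; rewrite -E.
Qed.

Definition circle_dist p q : R :=
  inf [set `|x - y| | x in [set x | \pi x = p] & y in [set y | \pi y = q]].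

Let S p q : set R :=
  [set `|x - y| | x in [set x | \pi x = p] & y in [set y | \pi y = q]].

Let has_inf_S p q : has_inf (S p q).
Proof.
split; last by exists 0 => _ [x _ [y _ <-]].
by exists `|repr p - repr q|; exists (repr p); rewrite /= ?reprK//;
  exists (repr q); rewrite /= ?reprK.
Qed.

Lemma circle_dist_pi x y : circle_dist (\pi x) (\pi y) <= `|x - y|.
Proof.
apply: ge_inf; first exact: (has_inf_S (\pi x) (\pi y)).2.
by exists x => //; exists y.
Qed.

Let dist_ge0 p q : 0 <= circle_dist p q.
Proof.
by apply: lb_le_inf; [exact: (has_inf_S p q).1 | move=> _ [x _ [y _ <-]]].
Qed.

Fact circle_distxx p : circle_dist p p = 0.
Proof.
apply/eqP; rewrite eq_le dist_ge0 andbT.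
by have := circle_dist_pi (repr p) (repr p); rewrite reprK subrr normr0.
Qed.

Fact circle_dist_positivity p q : circle_dist p q = 0 -> p = q.
Proof.
move=> pq0; apply: contrapT => pq; pose z := repr p - repr q.
have zN : z \isn't a Num.int.
  by apply/negP => /eq_pi_circle; rewrite !reprK.
have z0 : (Num.floor z)%:~R < z.
  by rewrite lt_neqAle -intrEfloor zN floor_le.
have z1 : z < (Num.floor z + 1)%:~R by rewrite floorD1_gt.
have m0 : 0 < Num.min (z - (Num.floor z)%:~R) ((Num.floor z + 1)%:~R - z).
  by rewrite lt_min !subr_gt0 z0.
have [_ [x px [y qy <-]]] := inf_adherent m0 (has_inf_S p q).
rewrite -/(circle_dist p q) pq0 add0r lt_min => /andP[].
have /eq_pi_circle/intrP[k kE] : \pi_(circle R) x = \pi_(circle R) (repr p) by rewrite reprK.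
have /eq_pi_circle/intrP[l lE] : \pi_(circle R) y = \pi_(circle R) (repr q) by rewrite reprK.
have -> : x - y = z - (l - k)%:~R.
  by rewrite rmorphB/= -kE -lE /z; ring.
case: (leP (l - k) (Num.floor z)) => lk.
  have lk' : (l - k)%:~R <= (Num.floor z)%:~R :> R by rewrite ler_int.
  move=> h _; move: h; rewrite ltNge => /negP; apply.
  by rewrite (le_trans _ (ler_norm _))// lerB.
have lk' : (Num.floor z + 1)%:~R <= (l - k)%:~R :> R by rewrite ler_int lezD1.
move=> _; rewrite ltNge => /negP; apply.
by rewrite distrC (le_trans _ (ler_norm _))// lerB.
Qed.

Fact circle_dist_sym p q : circle_dist p q = circle_dist q p.
Proof.
congr inf; apply/seteqP; split=> _ [x px [y qy <-]];
  by exists y => //; exists x => //; exact: distrC.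
Qed.

Fact circle_dist_triangle q p r :
  circle_dist p r <= circle_dist p q + circle_dist q r.
Proof.
apply/ler_addgt0Pr => e e0; have e20 : 0 < e / 2 by rewrite divr_gt0.
have [_ [x px [y qy <-]] xy] := inf_adherent e20 (has_inf_S p q).
have [_ [y' qy' [w rw <-]] yw] := inf_adherent e20 (has_inf_S q r).
have yy : \pi_(circle R) y = \pi y' by rewrite qy qy'.
have := circle_dist_pi x (w + (y - y')).
have -> : \pi_(circle R) (w + (y - y')) = r.
  rewrite -rw; apply/eq_pi_circle.
  by rewrite addrAC subrr add0r; apply/eq_pi_circle.
rewrite px => /le_trans; apply.
have -> : x - (w + (y - y')) = (x - y) + (y' - w) by ring.
apply: (le_trans (ler_normD _ _)).
have := ltrD xy yw.
rewrite -/(circle_dist p q) -/(circle_dist q r) => /ltW/le_trans; apply.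
by rewrite addrACA -splitr.
Qed.

HB.instance Definition _ := @isMetric.Build R (circle R) circle_dist
  circle_distxx circle_dist_positivity circle_dist_sym circle_dist_triangle.

Lemma pi_circle_continuous : continuous (\pi_(circle R) : R -> circle R).
Proof.
move=> x; apply/metricType_numDomainType.cvgrPdist_lt => e e0.
near=> y; apply: (le_lt_trans (circle_dist_pi x y)).
by near: y; exact: cvgr_dist_lt.
Unshelve. all: by end_near. Qed.

Lemma circle_compact : compact [set: circle R].
Proof.
have -> : [set: circle R] = \pi_(circle R) @` `[0, 1].
  apply/seteqP; split=> // p _; pose x := repr p.
  exists (x - (Num.floor x)%:~R).
    by have := floor_itv x; rewrite /= in_itv/= intrD; lra.
  rewrite -[RHS]reprK; apply/eq_pi_circle.
  by rewrite addrAC subrr add0r rpredN intr_int.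
apply: continuous_compact; last exact: segment_compact.
by apply: continuous_subspaceT => x; exact: pi_circle_continuous.
Qed.

End circle_metric.

(* As a numFieldType, R[i] gets its usual topology on the regular module R[i]^o;
   [normc] is the modulus with values in R, where `|z| has values in R[i]. *)
Definition circle_cts (R : realType) : Type :=
  continuousType (circle R) R[i]^o.

HB.instance Definition _ (R : realType) :=
  Choice.copy (circle_cts R) (continuousType (circle R) R[i]^o).

Definition circle_cts_fun (R : realType) (f : circle_cts R) : circle R -> R[i] :=
  f : continuousType (circle R) R[i]^o.
Coercion circle_cts_fun : circle_cts >-> Funclass.

Section sup_norm.
Variable R : realType.
Implicit Types f g h : circle_cts R.

Definition sup_norm (u : circle R -> R[i]) : R := sup [set normc (u x) | x in setT].

Lemma normc_continuous : continuous (@normc R : R[i]^o -> R).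
Proof.
move=> z; have FF : Filter (nbhs (z : R[i]^o)) by exact: nbhs_filter.
apply/(@cvgrPdist_lt _ R _ _ FF) => e e0.
have normCE (t : R[i]) : `|t| = ((normc t)%:C)%C by case: t.
exists ((e%:C)%C); first by rewrite /= ltcR.
move=> w /= zw; rewrite -ltcR (le_lt_trans _ zw)//.
have -> : (`|normc z - normc w|%:C)%C = `| `|z| - `|w| |.
  by rewrite !normCE -rmorphB/= expr0n/= addr0 sqrtr_sqr.
exact: ler_dist_dist.
Qed.

Lemma sup_norm_has_sup f g : has_sup [set normc (f x - g x) | x in setT].
Proof.
have cfg : continuous (fun x => normc (f x - g x) : R).
  move=> x; apply: (@continuous_comp _ R[i]^o R (fun x => (f x - g x : R[i]^o))).
    by apply: (@continuousB R[i] R[i]^o); exact: cts_fun.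
  exact: normc_continuous.
apply/compact_has_sup.
  by exists (normc (f 0 - g 0)); exists 0.
apply: continuous_compact; last exact: circle_compact.
exact: continuous_subspaceT.
Qed.

Fact sup_norm_distxx f : sup_norm (fun x => f x - f x) = 0.
Proof.
rewrite /sup_norm; have -> : [set normc (f x - f x) | x in setT] = [set 0].
  apply/seteqP; split=> [_ [x _ <-]|_ ->] /=; first by rewrite subrr normc0.
  by exists 0 => //; rewrite subrr normc0.
exact: sup1.
Qed.

Fact sup_norm_dist_positivity f g : sup_norm (fun x => f x - g x) = 0 -> f = g.
Proof.
move=> fg0; apply/continuousEP => x.
apply/eqP; rewrite -subr_eq0; apply/eqP/eq0_normc/eqP.
rewrite eq_le; apply/andP; split.
  rewrite -[leRHS]fg0; apply: ub_le_sup; first exact: (sup_norm_has_sup f g).2.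
  by exists x.
by case: (_ - _) => a b; exact: sqrtr_ge0.
Qed.

Fact sup_norm_dist_sym f g :
  sup_norm (fun x => f x - g x) = sup_norm (fun x => g x - f x).
Proof.
congr sup; apply/seteqP; split=> _ [x _ <-]; exists x => //;
  by rewrite -normcN opprB.
Qed.

Fact sup_norm_dist_triangle g f h :
  sup_norm (fun x => f x - h x) <=
  sup_norm (fun x => f x - g x) + sup_norm (fun x => g x - h x).
Proof.
apply: ge_sup; first exact: (sup_norm_has_sup f h).1.
move=> _ [x _ <-]; rewrite -(subrKA (g x)).
by apply: (le_trans (le_normcD _ _)); apply: lerD; apply: ub_le_sup;
  [exact: (sup_norm_has_sup f g).2 | exists x
  |exact: (sup_norm_has_sup g h).2 | exists x].
Qed.

HB.instance Definition _ := @isMetric.Build R (circle_cts R)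
  (fun f g => sup_norm (fun x => f x - g x)) sup_norm_distxx
  sup_norm_dist_positivity sup_norm_dist_sym sup_norm_dist_triangle.

End sup_norm.

Section fourier.
Variable R : realType.
Implicit Types (x : circle R) (k : int) (n : nat) (u : circle R -> R[i]).
Local Open Scope complex_scope.

Definition circle_integral u : R[i] :=
  (\int[lebesgue_measure]_(t in `[0%R, 1%R]) complex.Re (u (\pi t))) +i*
  (\int[lebesgue_measure]_(t in `[0%R, 1%R]) complex.Im (u (\pi t))).

Definition circle_exp k x : R[i] :=
  let t := 2 * pi * k%:~R * repr x in cos t +i* sin t.

Lemma circle_exp_pi k (t : R) :
  circle_exp k (\pi t) =
  cos (2 * pi * k%:~R * t) +i* sin (2 * pi * k%:~R * t).
Proof.
have per (u : R) (m : int) :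
    cos (u + 2 * pi * m%:~R) = cos u /\ sin (u + 2 * pi * m%:~R) = sin u.
  have pos (v : R) (d : nat) :
      cos (v + 2 * pi * d%:R) = cos v /\ sin (v + 2 * pi * d%:R) = sin v.
    rewrite mulr_natr [2 * pi]mulr_natl.
    by rewrite (periodicn (@cosD2pi R)) (periodicn (@sinD2pi R)).
  case: m => d; first exact: pos.
  rewrite NegzE rmorphN mulrN.
  by have [] := pos (u - 2 * pi * d.+1%:R) d.+1; rewrite subrK => <- <-.
have /eq_pi_circle/intrP[m mE] : \pi_(circle R) (repr (\pi_(circle R) t)) = \pi t.
  by rewrite reprK.
rewrite /circle_exp.
have -> : 2 * pi * k%:~R * repr (\pi_(circle R) t) =
    2 * pi * k%:~R * t + 2 * pi * (k * m)%:~R.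
  by rewrite intrM -mE; ring.
by have [-> ->] := per (2 * pi * k%:~R * t) (k * m).
Qed.

Definition fourier_coef u k : R[i] :=
  circle_integral (fun x => u x * (circle_exp k x)^*).

(* The index j stands for the frequency k = j - n in [-n, n]. *)
Definition fourier_sum n u x : R[i] :=
  \sum_(0 <= j < n.*2.+1)
    fourier_coef u (j%:Z - n%:Z) * circle_exp (j%:Z - n%:Z) x.

(* [lne] maps 0 to -oo. *)
Definition divergence_set (beta : R) u : set (circle R) :=
  [set x | limn_esup (fun n =>
     lne (normc (fourier_sum n u x))%:E / (ln (ln n%:R))%:E)%E = beta%:E].

End fourier.

Section hausdorff.
Variables (R : realType) (X : metricType R).
Implicit Types (A : set X) (s delta : R).
Local Open Scope ereal_scope.

(* The diameter is -oo on the empty set, whence the case split below. *)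
Definition diameter A : \bar R :=
  ereal_sup [set (mdist x y)%:E | x in A & y in A].

Definition diameter_pow s A : \bar R :=
  if A == set0 then 0 else diameter A `^ s.

Definition hausdorff_content s delta A : \bar R :=
  ereal_inf [set \sum_(0 <= i <oo) diameter_pow s (U i) | U in
    [set U : (set X)^nat |
      (forall i, diameter (U i) <= delta%:E) /\ A `<=` \bigcup_i U i]].

Definition hausdorff_measure s A : \bar R :=
  ereal_sup [set hausdorff_content s delta A | delta in [set d | (0 < d)%R]].

Definition hausdorff_dim A : \bar R :=
  ereal_inf [set s%:E | s in [set s | (0 <= s)%R /\ hausdorff_measure s A = 0]].

End hausdorff.

Definition residual (X : topologicalType) (A : set X) : Prop :=
  exists U : (set X)^nat,
    (forall n, open (U n) /\ dense (U n)) /\ \bigcap_n U n `<=` A.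

(* Main.v *)
Require Import Defs.
From HB Require Import structures.
From mathcomp Require Import all_boot all_order all_algebra archimedean.
From mathcomp Require Import all_classical all_reals all_analysis measurable_realfun.
From mathcomp Require Import complex ring lra zify.
Set Implicit Arguments.
Unset Strict Implicit.
Unset Printing Implicit Defensive.
Import Order.TTheory GRing.Theory Num.Theory.
Import numFieldNormedType.Exports.
Import Normc.
Local Open Scope classical_set_scope.
Local Open Scope ring_scope.

(* Lower bound on the dimension.  Let h_m = i e_m sum_(1 <= k <= m) sin(2 pi k x) / k, a
   trigonometric polynomial with |h_m| <= 12 for all m whose m-th partial sum exceeds
   (log m) / 4 near 0.  Dilating by N = m ^ k, the partial sum of order n = N m of
   h_m(N x) exceeds (log n) / (4 (k + 1)) on the arcs [j / N, j / N + 1 / (16 m N)], and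
   these arcs are almost as long as their spacing 1 / N when k is large.  Adding small
   multiples of h_m(N x) to trigonometric polynomials gives, for each k, a dense open set
   of functions with |S_n f| >= (log n) ^ (1 - 1 / (k + 1)) on all of these arcs.  If f
   belongs to all these open sets, the limsup of the arcs lies in {limsup >= 1}, and it
   has dimension at least 1: a cover (U_i) with small sum of diam(U_i) ^ s is avoided by
   a nested sequence of arcs, each chosen by averaging over the candidates.

   Upper bounds.  |S_n f| <= C |f| log n gives limsup <= 1 for every continuous f, and the
   dimension of the circle is at most 1. *)

(** * Dimension of limsup sets of arcs *)

(** The choice N = m ^ k reconciles two opposite demands. Since n = m ^ (k + 1), log n is only k + 1
    times log m: the large partial sum keeps the order log n up to a factor that depends on k alone,
    and the weaker exponent 1 - 1 / (k + 1) absorbs this factor once m is large. On the other side,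
    passing from an interval of length l to arcs of length r needs (l / r) ^ s < l N / 4, which
    amounts to (k + 1) s <= k - 1 up to constants, that is k >= (1 + s) / (1 - s). Each open set has
    its own fixed k, while the limsup set lets k grow, so every s < 1 is reached. A function picks
    its own m for each k, so the dimension bound has to hold for any sequence with m k >= k; each
    refinement skips ahead to a k chosen after the current interval is known. The nested
    construction takes place on the real line, inside [0, 1/2], where the projection to the circle
    does not shrink distances. *)

Lemma card_spread (M D : nat) (P : pred 'I_M) :
  (forall i j, P i -> P j -> (j <= i + D)%N) -> (#|P| <= D.+1)%N.
Proof.
move=> h; have [/pred0P e|/pred0Pn[j0 Pj0]] := boolP (pred0b P).
  by rewrite (eq_card0 e).
pose a := [arg min_(i < j0 | P i) (i : nat)].
have [Pa amin] : P a /\ forall j, P j -> (a <= j)%N.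
  by rewrite /a; case: arg_minnP.
pose g (j : 'I_M) : 'I_D.+1 := inord (j - a).
have gi : {in P &, injective g}.
  move=> i j Pi Pj /(congr1 val); rewrite /= !inordK; last first.
  - by rewrite ltnS leq_subLR; exact: h.
  - by rewrite ltnS leq_subLR; exact: h.
  move=> e; apply/val_inj => /=.
  by rewrite -(subnK (amin _ Pi)) e subnK// amin.
by rewrite -(card_in_image gi) -[leqRHS]card_ord; exact: max_card.
Qed.

Section limsup_cover.
Variables (R : realType) (W : nat -> set R) (e : nat -> R) (s : R).
Hypothesis e_gt0 : forall i, 0 < e i.
Hypothesis W_diam : forall i x y, W i x -> W i y -> `|x - y| <= e i.
Hypothesis s_gt0 : 0 < s.
Hypothesis s_lt1 : s < 1.

Definition hits i (a l : R) := `[< exists2 x, W i x & a <= x <= a + l >].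

(* The sets W_i that meet the interval [a, a + l] are too small to cover it. *)
Definition light (a l : R) := forall n,
  \sum_(i < n | hits i a l) e i `^ s <= (l / 16) `^ s.

Lemma light_le a l i : 0 < l -> light a l -> hits i a l -> e i <= l / 16.
Proof.
move=> l0 /(_ i.+1) + mi; rewrite (bigD1 ord_max)//= => h.
have {}h : e i `^ s <= (l / 16) `^ s.
  by apply: le_trans h; rewrite lerDl sumr_ge0// => j _; exact: powR_ge0.
rewrite leNgt; apply/negP => /(gt0_ltr_powR s_gt0).
by rewrite !nnegrE ltW//= ?ltW// ?divr_gt0// ltNge h => /(_ isT isT).
Qed.

(** Every e_i that counts is at most l / 16, so e_i = e_i ^ s e_i ^ (1 - s) is at most e_i ^ s (l /
    16) ^ (1 - s): because s < 1, control of the s-th powers also controls the total length. *)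
Lemma light_sum a l n : 0 < l -> light a l ->
  \sum_(i < n | hits i a l) e i <= l / 16.
Proof.
move=> l0 la; have l16 : 0 < l / 16 by rewrite divr_gt0.
have split1 x : 0 < x -> x = x `^ s * x `^ (1 - s).
  move=> x0; rewrite -powRD ?subrKC ?powRr1//; first exact: ltW.
  by rewrite oner_eq0.
rewrite [leRHS]split1//.
apply: (@le_trans _ _ (\sum_(i < n | hits i a l) e i `^ s * (l / 16) `^ (1 - s))).
  apply: ler_sum => i mi; rewrite {1}(split1 (e i))// ler_wpM2l ?powR_ge0//.
  by apply: ge0_ler_powR; rewrite ?nnegrE ?(light_le l0 la)// ?subr_ge0 ltW.
by rewrite -mulr_suml ler_wpM2r ?powR_ge0.
Qed.

(** If two of the intervals meet W_i, their starting points lie within e_i + r, so their indices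
    differ by at most N e_i + 1 / 2. When 2 N e_i < 1 this excludes distinct indices; otherwise at
    most 2 N e_i + 1 <= 4 N e_i indices fit. *)
Lemma hits_count (i p M N : nat) (r : R) : (0 < N)%N -> 0 <= r ->
  r * (2 * N%:R) <= 1 ->
  let c : R := #|[pred j : 'I_M | hits i ((p + j)%:R / N%:R) r]|%:R in
  c <= 4 * N%:R * e i \/ c <= 1.
Proof.
move=> N0 r0 rN c; have N0' : 0 < N%:R :> R by rewrite ltr0n.
have key (j k : 'I_M) : hits i ((p + j)%:R / N%:R) r ->
    hits i ((p + k)%:R / N%:R) r -> k%:R <= j%:R + N%:R * e i + 2^-1.
  move=> /asboolP[x Wx /andP[_ xj]] /asboolP[y Wy /andP[yk _]].
  have xy : y <= x + e i by have := W_diam Wx Wy; rewrite distrC ler_norml; lra.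
  have : (p + k)%:R / N%:R <= (p + j)%:R / N%:R + r + e i by lra.
  rewrite ler_pdivrMr// !mulrDl mulfVK ?gt_eqF// !natrD.
  have : r * N%:R <= 2^-1 by lra.
  by rewrite [e i * _]mulrC; lra.
have [big|small] := leP 1 (2 * N%:R * e i); [left|right]; last first.
  have : (#|[pred j : 'I_M | hits i ((p + j)%:R / N%:R) r]| <= 1)%N.
    apply: (@card_spread _ 0) => j k mj mk; rewrite addn0 -ltnS -(@ltr_nat R).
    by have := key _ _ mj mk; rewrite -[j.+1%:R]natr1; lra.
  by rewrite -(ler_nat R).
have t0 : 0 <= 2 * N%:R * e i by rewrite (le_trans _ big).
have := truncn_itv t0; set D := Num.truncn _ => /andP[D1 D2].
have : (#|[pred j : 'I_M | hits i ((p + j)%:R / N%:R) r]| <= D.+1)%N.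
  apply: card_spread => j k mj mk; rewrite -ltnS -(@ltr_nat R).
  by have := key _ _ mj mk; rewrite -addnS natrD; lra.
by rewrite -(ler_nat R) -[D.+1%:R]natr1 /c; lra.
Qed.

(** Averaging over M >= l N / 2 grid intervals. Sets that may meet several of them have weight at
    most 1 on each and contribute at most 4 N (l / 16) = l N / 4 by [light_sum]; sets that meet at
    most one contribute at most (l / r) ^ s < l N / 4 altogether. The total is below M, so some
    interval receives less than 1. *)
Lemma light_step a l (N : nat) (r : R) : 0 <= a -> 0 < l -> light a l ->
    (0 < N)%N -> 0 < r -> r * (2 * N%:R) <= 1 -> 6 <= l * N%:R ->
    (l / r) `^ s < l * N%:R / 4 ->
  exists j : nat, [/\ light (j%:R / N%:R) r, a <= j%:R / N%:R &
    j%:R / N%:R + r <= a + l].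
Proof.
move=> a0 l0 la N0 r0 rN lN lr; have N0' : 0 < N%:R :> R by rewrite ltr0n.
(* The 2 subtracted covers the rounding up of a N to [p] and the length r <= 1 / (2 N) of the last
   interval; l N >= 6 makes l N - 3 >= l N / 2. *)
have [M M1 M2] : exists2 M : nat, l * N%:R / 2 <= M%:R & M%:R <= l * N%:R - 2.
  have t0 : 0 <= l * N%:R - 2 by lra.
  have := truncn_itv t0; set t := Num.truncn _ => /andP[h1 h2]; exists t => //.
  by move: h2; rewrite -[t.+1%:R]natr1; lra.
have [p p1 p2] : exists2 p : nat, a * N%:R <= p%:R & p%:R <= a * N%:R + 1.
  have t0 : 0 <= a * N%:R by rewrite mulr_ge0.
  have := truncn_itv t0; set t := Num.truncn _ => /andP[h1 h2].
  by exists t.+1; [exact: ltW | rewrite -[t.+1%:R]natr1; lra].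
pose x (j : 'I_M) : R := (p + j)%:R / N%:R.
have xa j : a <= x j.
  by rewrite /x ler_pdivlMr// natrD (le_trans p1)// lerDl.
have xl j : x j + r <= a + l.
  rewrite -lerBrDr /x ler_pdivrMr// natrD !mulrDl mulNr.
  by have : j%:R + 1 <= M%:R :> R; [rewrite natr1 ler_nat|lra].
have sub i j : hits i (x j) r -> hits i a l.
  move=> /asboolP[y Wy /andP[y1 y2]]; apply/asboolP; exists y => //.
  by rewrite (le_trans (xa j))// (le_trans y2).
(* With this weight, a total below 1 forces every W_i met to have e i ^ s < (r / 16) ^ s,
   so that the minimum is never 1 and the total is the one bounded in [light]. *)
pose phi i := Num.min 1 (e i `^ s / (r / 16) `^ s).
have r16 : 0 < (r / 16) `^ s by rewrite powR_gt0// divr_gt0.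
have phi_ge0 i : 0 <= phi i by rewrite le_min ler01 divr_ge0 ?powR_ge0.
have phi_le i : phi i <= e i `^ s / (r / 16) `^ s by rewrite ge_min lexx orbT.
have phi1 i : phi i <= 1 by rewrite ge_min lexx.
have avg n : exists j : 'I_M, \sum_(i < n | hits i (x j) r) phi i < 1.
  apply: contrapT => /forallNP h.
  have : \sum_(j < M) 1 <= \sum_(j < M) \sum_(i < n | hits i (x j) r) phi i.
    by apply: ler_sum => j _; rewrite leNgt; apply/negP; exact: h.
  rewrite sumr_const card_ord (exchange_big_dep (fun i : 'I_n => hits i a l))/=;
    last by move=> j i _; exact: sub.
  apply/negP; rewrite -ltNge.
  apply: (@le_lt_trans _ _ (\sum_(i < n | hits i a l)
      (4 * N%:R * e i + e i `^ s / (r / 16) `^ s))).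
    apply: ler_sum => i _; rewrite sumr_const.
    have := @hits_count i p M N r N0 (ltW r0) rN.
    set c := _%:R => /= ch; rewrite (_ : phi i *+ _ = c * phi i); last by rewrite mulr_natl.
    case: ch => h'.
      apply: (@le_trans _ _ (4 * N%:R * e i)).
        by rewrite (le_trans _ h')// ler_piMr// ler0n.
      by rewrite lerDl divr_ge0 ?powR_ge0.
    apply: (@le_trans _ _ (e i `^ s / (r / 16) `^ s)).
      by rewrite (le_trans _ (phi_le i))// ler_piMl.
    by rewrite lerDr mulr_ge0// ?mulr_ge0// ltW.
  rewrite big_split/= -mulr_sumr -mulr_suml.
  have h1 : 4 * N%:R * (\sum_(i < n | hits i a l) e i) <= l * N%:R / 4.
    have := light_sum n l0 la; set S := \sum_(i < n | _) _ => hS.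
    have : N%:R * S <= N%:R * (l / 16) by rewrite ler_pM2l.
    by rewrite -mulrA; lra.
  have h2 : (\sum_(i < n | hits i a l) e i `^ s) / (r / 16) `^ s < l * N%:R / 4.
    apply: le_lt_trans lr; rewrite ler_pdivrMr//.
    apply: (le_trans (la n)); rewrite -powRM ?divr_ge0 ?(ltW l0) ?(ltW r0)//.
    by rewrite mulrA mulfVK ?gt_eqF.
  by lra.
(* [avg] gives an index for each n; finitely many candidates make it uniform in n. *)
suff [j Hj] : exists j : 'I_M, light (x j) r by exists (p + j)%N; split; [|exact: xa|exact: xl].
apply: contrapT => /forallNP h.
have {}h j : exists n, ~~ (\sum_(i < n | hits i (x j) r) e i `^ s <= (r / 16) `^ s).
  by have /existsNP[n /negP hn] := h j; exists n.
have {h}[n nP] := choice h.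
have [j Gj] := avg (\max_j n j)%N; move/negP: (nP j); apply.
have phiE (i : 'I_(\max_j n j)) : hits i (x j) r ->
    phi i = e i `^ s / (r / 16) `^ s.
  move=> mi; rewrite /phi; case: (leP 1 (e i `^ s / (r / 16) `^ s)) => // h.
  have : phi i <= \sum_(i < (\max_j n j)%N | hits i (x j) r) phi i.
    by rewrite (bigD1 i)//= lerDl sumr_ge0.
  by rewrite /phi min_l// leNgt Gj.
apply: (@le_trans _ _ (\sum_(i < (\max_j n j)%N | hits i (x j) r) e i `^ s)).
  rewrite (big_ord_widen_cond (\max_j n j)%N (fun i => hits i (x j) r)
    (fun i => e i `^ s)); last exact: leq_bigmax.
  rewrite [leRHS](bigID (fun i : 'I__ => (i < n j)%N))/= lerDl sumr_ge0// => i _.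
  exact: powR_ge0.
move: Gj; rewrite (eq_bigr _ phiE) -mulr_suml ltr_pdivrMr// mul1r.
exact: ltW.
Qed.

Definition grid_size (m k : nat) : R := (m ^ k)%:R.
(** The factor 16 keeps the phases 2 pi i (N x - j), for i <= m, at most 1 / 2 on the arc that
    starts at j / N, so that all cosines in the partial sum are at least 1 / 2. *)
Definition arc_length (m k : nat) : R := (16 * m%:R * grid_size m k)^-1.

Lemma light_refine a l (K : nat) (m : nat -> nat) : (forall k, (k <= m k)%N) ->
    0 <= a -> 0 < l -> light a l ->
  exists k j : nat, [/\ (K <= k)%N, light (j%:R / grid_size (m k) k) (arc_length (m k) k),
    a <= j%:R / grid_size (m k) k, 0 < arc_length (m k) k &
    j%:R / grid_size (m k) k + arc_length (m k) k <= a + l].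
Proof.
move=> mk a0 l0 la.
(* k > 6 / l ensures l N >= 6. For the other condition, l / r = 16 l m ^ (k + 1): k > (1 + s) / (1 -
   s) gives (m ^ (k + 1)) ^ s <= m ^ (k - 1), and k > 4 (16 l) ^ s / l with m >= k gives (16 l) ^ s
   < l m / 4. *)
pose B := Num.max (Num.max (6 / l) (4 * (16 * l) `^ s / l)) ((1 + s) / (1 - s)).
pose k := maxn K (Num.truncn B).+1; exists k.
have B0 : 0 <= B by rewrite !le_max divr_ge0// ltW.
have kB : B < k%:R.
  have /andP[_ h] := truncn_itv B0; apply: (lt_le_trans h).
  by rewrite ler_nat leq_maxr.
have k0 : (0 < k)%N by rewrite /k leq_max orbT.
have m0 : (0 < m k)%N by exact: leq_trans (mk k).
have km : k%:R <= (m k)%:R :> R by rewrite ler_nat.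
have m1 : 1 <= (m k)%:R :> R by rewrite ler1n.
have := kB; rewrite !gt_max => /andP[/andP[]].
rewrite ltr_pdivrMr// ltr_pdivrMr// ltr_pdivrMr ?subr_gt0// => k1 k2 k3.
have kE : (m k ^ k = m k * m k ^ k.-1)%N by rewrite -expnS prednK.
have bE : grid_size (m k) k = (m k)%:R * (m k)%:R ^+ k.-1.
  by rewrite /grid_size kE natrM natrX.
have b1 : 1 <= (m k)%:R ^+ k.-1 :> R by rewrite exprn_ege1.
have b0 : 0 < grid_size (m k) k by rewrite ltr0n expn_gt0 m0.
have mr0 : 0 < (m k)%:R :> R by rewrite ltr0n.
have r0 : 0 < arc_length (m k) k by rewrite invr_gt0 !mulr_gt0.
have mb : k%:R <= grid_size (m k) k.
  by rewrite (le_trans km)// bE ler_peMr// ltW.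
have [||||j [? ? ?]] := @light_step a l (m k ^ k)%N (arc_length (m k) k) a0 l0 la _ r0.
- by rewrite expn_gt0 m0.
- rewrite -/(grid_size _ _) /arc_length mulrC ler_pdivrMr ?mulr_gt0// mul1r.
  have : grid_size (m k) k <= (m k)%:R * grid_size (m k) k by rewrite ler_peMl// ltW.
  by move: b0; clear; move: (grid_size (m k) k) ((m k)%:R : R) => b c; lra.
- rewrite -/(grid_size _ _); have := ler_wpM2l (ltW l0) mb; move: k1; clear.
  by move: (grid_size (m k) k) (k%:R : R) => b c; lra.
- rewrite -/(grid_size _ _) /arc_length invrK.
  have -> : l * (16 * (m k)%:R * grid_size (m k) k) = (16 * l) * (m k)%:R ^+ k.+1.
    have -> : (m k)%:R ^+ k.+1 = (m k)%:R * ((m k)%:R * (m k)%:R ^+ k.-1) :> R.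
      by rewrite -!exprS prednK.
    rewrite bE.
    by rewrite -[16 * _ * _]mulrA mulrCA mulrA.
  rewrite powRM ?exprn_ge0// ?mulr_ge0 ?(ltW l0)//.
  have h : ((m k)%:R ^+ k.+1) `^ s <= (m k)%:R ^+ k.-1 :> R.
    rewrite -!powR_mulrn// -powRrM ler_powR//.
    have : k%:R = k.-1%:R + 1 :> R by rewrite natr1 prednK.
    rewrite -[k.+1%:R]natr1; move: k3; clear.
    by move: (k%:R : R) (k.-1%:R : R) => b c; lra.
  apply: le_lt_trans (ler_wpM2l (powR_ge0 _ _) h) _.
  rewrite bE [l * _]mulrA [ltRHS]mulrAC ltr_pM2r; last by rewrite (lt_le_trans ltr01).
  have := ler_wpM2r (ltW l0) km; move: k2; clear.
  by move: (k%:R : R) ((m k)%:R : R) (_ `^ s) => b c d; lra.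
by exists j; split => //; rewrite leq_maxl.
Qed.

(** The supremum of the left ends lies in all the nested intervals. It avoids W_i because a light
    interval of length l meets only sets with e_i <= l / 16, whereas the lengths tend to 0 and e_i >
    0. *)
Lemma light_limsup (m : nat -> nat) : (forall k, (k <= m k)%N) ->
    light 0 2^-1 ->
  exists x : R, [/\ 0 <= x <= 2^-1, forall i, ~ W i x &
    forall K, exists k j : nat, (K <= k)%N /\
      j%:R / grid_size (m k) k <= x <= j%:R / grid_size (m k) k + arc_length (m k) k].
Proof.
move=> mk la0.
pose good (t : nat * (R * R)) := [/\ light t.2.1 t.2.2, 0 <= t.2.1 & 0 < t.2.2].
pose T := {t | good t}.
pose step (t u : T) : Prop := [/\ ((sval t).1 < (sval u).1)%N,
  (sval t).2.1 <= (sval u).2.1,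
  (sval u).2.1 + (sval u).2.2 <= (sval t).2.1 + (sval t).2.2,
  (sval u).2.2 = arc_length (m (sval u).1) (sval u).1 &
  exists j : nat, (sval u).2.1 = j%:R / grid_size (m (sval u).1) (sval u).1].
have stepP (t : T) : {u : T | step t u}.
  apply: cid; case: t => -[K [a l]] /= la; have [/= la1 a1 l1] := la.
  have [k [j [Kk lk ak rk kl]]] := @light_refine a l K.+1 m mk a1 l1 la1.
  have P : good (k, (j%:R / grid_size (m k) k, arc_length (m k) k)).
    by split => //=; exact: le_trans ak.
  by exists (exist _ _ P); split => //=; exists j.
have P0 : good (0%N, (0, 2^-1)) by split => //=.
have [f [f0 fS]] := dependent_choice stepP (exist _ _ P0).
pose k n := (sval (f n)).1; pose a n := (sval (f n)).2.1; pose l n := (sval (f n)).2.2.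
have l0 n : 0 < l n by rewrite /l; case: (f n) => -[? [? ?]] [].
have lal n : light (a n) (l n) by rewrite /l /a; case: (f n) => -[? [? ?]] [].
have ain : {homo a : i j / (i <= j)%N >-> i <= j}.
  by apply: homo_leq => [//|? ? ?|n]; [exact: le_trans | have [] := fS n].
have alin : {homo (fun n => a n + l n) : i j / (i <= j)%N >-> j <= i}.
  apply: (@homo_leq _ (fun n => a n + l n) (fun x y => y <= x)) => [//|? ? ? h1 h2|n];
    [exact: le_trans h2 h1 | by have [] := fS n].
have kn n : (n <= k n)%N.
  by elim: n => // n IH; rewrite (leq_ltn_trans IH)//; have [] := fS n.
pose x := sup (range a).
have aub n : ubound (range a) (a n + l n).
  move=> _ [j _ <-]; rewrite (le_trans (ain _ _ (leq_maxl j n)))//.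
  by rewrite (le_trans _ (alin _ _ (leq_maxr j n)))// lerDl ltW.
have ax n : a n <= x by apply: ub_le_sup; [exists (a 0%N + l 0%N)|exists n].
have xa n : x <= a n + l n by apply: ge_sup; [exists (a 0%N), 0%N|].
have xI n : a n <= x <= a n + l n by rewrite ax xa.
have kr n : l n.+1 = arc_length (m (k n.+1)) (k n.+1) by have [] := fS n.
exists x; split.
- by have := xI 0%N; rewrite /a /l f0 /= add0r.
- move=> i Wi; have ei n : e i <= l n.
    have := @light_le (a n) (l n) i (l0 n) (lal n).
    have : hits i (a n) (l n) by apply/asboolP; exists x.
    by move=> + h => /h; have := l0 n; lra.
  have B0 : 0 <= (e i)^-1 by rewrite invr_ge0 ltW.
  have := truncn_itv B0; set n := Num.truncn _ => /andP[_ hn].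
  have := ei n.+1; rewrite kr leNgt => /negP; apply.
  rewrite -[ltRHS]invrK ltf_pV2 ?posrE ?invr_gt0//; last first.
    have := l0 n.+1; rewrite kr invr_gt0//.
  apply: (lt_le_trans hn); apply: (@le_trans _ _ (m (k n.+1))%:R).
    by rewrite ler_nat (leq_trans (kn n.+1)).
  have : 1 <= grid_size (m (k n.+1)) (k n.+1).
    by rewrite ler1n expn_gt0 (leq_trans _ (mk _))// (leq_trans _ (kn _)).
  by have : 0 <= (m (k n.+1))%:R :> R; [exact: ler0n|nra].
(* Index 0 is the starting interval [0, 1/2], which is not a grid arc; hence [K.+1]. *)
- move=> K; exists (k K.+1); have [_ _ _ _ [j jE]] := fS K; exists j.
  split; first by rewrite (leq_trans _ (kn _)).
  by rewrite -jE -kr; exact: xI.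
Qed.

End limsup_cover.

(** * Hausdorff dimension of subsets of the circle *)

Section hausdorff_lemmas.
Variables (R : realType) (X : metricType R).
Implicit Types (A : set X) (s : R).
Local Open Scope ereal_scope.

Lemma diameter_ge0 A : A !=set0 -> 0 <= diameter A.
Proof.
move=> [x Ax]; apply: ereal_sup_ubound; exists x => //; exists x => //.
by rewrite mdistxx.
Qed.

Lemma diameter_pow_ge0 s A : 0 <= diameter_pow s A.
Proof. by rewrite /diameter_pow; case: ifP => // _; exact: poweR_ge0. Qed.

Lemma hausdorff_content_ge0 s delta A : 0 <= hausdorff_content s delta A.
Proof.
apply: le_ereal_inf_tmp => _ [U _ <-]; apply: nneseries_ge0 => i _ _.
exact: diameter_pow_ge0.
Qed.

Lemma hausdorff_measure_ge0 s A : 0 <= hausdorff_measure s A.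
Proof.
apply: (le_trans (hausdorff_content_ge0 s 1 A)).
by apply: ereal_sup_ubound; exists 1%R => //=.
Qed.

End hausdorff_lemmas.

Section circle_dimension.
Variable R : realType.
Implicit Types (A : set (circle R)) (s x y : R).

(** Other representatives change x - y by an integer; a nonzero one leaves at least 1 - 1 / 2, which
    is no less than |x - y|. This allows covers of the circle to be lifted to [0, 1/2] without
    increasing diameters. *)
Lemma mdist_circle_half x y : 0 <= x <= 2^-1 -> 0 <= y <= 2^-1 ->
  `|x - y| <= mdist (\pi_(circle R)%qT x) (\pi_(circle R)%qT y).
Proof.
move=> /andP[x0 x2] /andP[y0 y2]; apply: lb_le_inf.
  by exists `|x - y|; exists x => //; exists y.
move=> _ [x' /eq_pi_circle/intrP[i xi] [y' /eq_pi_circle/intrP[j yj] <-]].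
have -> : x' - y' = x - y + (i - j)%:~R.
  by rewrite intrB -xi -yj; ring.
have [->|ij] := eqVneq i j; first by rewrite subrr addr0.
have : 1 <= `|(i - j)%:~R| :> R.
  by rewrite -intr_norm -[1]/(1%:~R) ler_int -gtz0_ge1 normr_gt0 subr_eq0.
have := ler_normB (x - y + (i - j)%:~R) (x - y).
rewrite addrAC subrr add0r.
have : `|x - y| <= 2^-1 by rewrite ler_norml; lra.
by lra.
Qed.

Local Open Scope ereal_scope.

(** The n arcs of length 1 / n cost n ^ (1 - s), which tends to 0; beyond the threshold [B] both 1 /
    n <= delta and n ^ (1 - s) <= eps hold. *)
Lemma hausdorff_measure_circle0 s A : (1 < s)%R -> hausdorff_measure s A = 0.
Proof.
move=> s1; apply/eqP; rewrite eq_le hausdorff_measure_ge0 andbT.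
apply: ge_ereal_sup => _ [delta /= d0 <-].
apply/lee_addgt0Pr => eps e0; rewrite add0e.
pose B := (delta^-1 + eps^-1 `^ (s - 1)^-1)%R.
have d0' : (0 < delta^-1)%R by rewrite invr_gt0.
have B0 : (0 <= B)%R by rewrite addr_ge0 ?powR_ge0// ltW.
pose n := (Num.truncn B).+1.
have n0 : (0 < n%:R :> R)%R by rewrite ltr0n.
have Bn : (B < n%:R)%R by have /andP[] := truncn_itv B0.
have nd : (n%:R^-1 <= delta)%R.
  rewrite -[leRHS]invrK lef_pV2 ?posrE// (le_trans _ (ltW Bn))//.
  by rewrite lerDl powR_ge0.
have ne : (n%:R * n%:R^-1 `^ s <= eps)%R.
  have -> : (n%:R^-1 `^ s = n%:R^-1 * (n%:R `^ (s - 1))^-1)%R.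
    rewrite -[in LHS](subrKC 1%R s) [LHS]powRD; last first.
      by rewrite invr_eq0 (gt_eqF n0) implybT.
    rewrite powRr1 ?invr_ge0//; congr (_ * _)%R.
    by rewrite -[in LHS]powR_inv1// -[in RHS]powR_inv1 ?powR_ge0// -!powRrM mulrC.
  rewrite mulrA divff ?gt_eqF// mul1r -[leRHS]invrK.
  rewrite lef_pV2 ?posrE ?invr_gt0 ?powR_gt0//.
  have -> : (eps^-1 = (eps^-1 `^ (s - 1)^-1) `^ (s - 1))%R.
    by rewrite -powRrM mulVf ?powRr1 ?invr_ge0 ?ltW// subr_eq0 gt_eqF.
  apply: ge0_ler_powR; rewrite ?nnegrE ?powR_ge0 ?subr_ge0 ?(ltW s1) ?(ltW n0)//.
  by rewrite (le_trans _ (ltW Bn))// lerDr ltW.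
pose U i : set (circle R) := if (i < n)%N then
  \pi_(circle R)%qT @` `[(i%:R / n%:R)%R, (i.+1%:R / n%:R)%R] else set0.
have diamU i : diameter (U i) <= (n%:R^-1)%:E.
  apply: ge_ereal_sup => _ [p Up [q Uq <-]]; rewrite lee_fin.
  move: Up Uq; rewrite /U; case: ifP => // _ [x + <-] [y + <-].
  rewrite /= !in_itv/= => /andP[x1 x2] /andP[y1 y2].
  apply: (le_trans (circle_dist_pi x y)); rewrite ler_norml.
  by move: x2 y2; rewrite -natr1 mulrDl mul1r; lra.
have powU i : diameter_pow s (U i) <= (n%:R^-1 `^ s)%:E.
  rewrite /diameter_pow; case: ifPn => [_|/set0P U0].
    by rewrite lee_fin powR_ge0.
  rewrite -poweR_EFin; apply: gt0_ler_poweR; rewrite ?in_itv/= ?leey ?andbT//.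
  - by rewrite ltW// (lt_trans ltr01).
  - exact: diameter_ge0.
apply: ge_ereal_inf; exists (\sum_(0 <= i <oo) diameter_pow s (U i)).
  exists U => //; split => [i|p _]; first by rewrite (le_trans (diamU i))// lee_fin.
  pose x := (repr p - (Num.floor (repr p))%:~R)%R.
  have [x0 x1] : (0 <= x)%R /\ (x < 1)%R.
    by have := floor_itv (repr p); rewrite intrD /x; lra.
  have xp : \pi_(circle R)%qT x = p.
    rewrite -[RHS]reprK; apply/eq_pi_circle.
    by rewrite /x addrAC subrr add0r rpredN intr_int.
  have t0 : (0 <= x * n%:R)%R by rewrite mulr_ge0.
  have := truncn_itv t0; set i := Num.truncn _ => /andP[h1 h2].
  have i_n : (i < n)%N by rewrite -(ltr_nat R) (le_lt_trans h1)// gtr_pMl.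
  exists i => //; rewrite /U i_n; exists x => //=; rewrite in_itv/=.
  by rewrite ler_pdivrMr// h1 ler_pdivlMr// ltW.
rewrite (@nneseries_split _ _ 0 n); last by move=> *; exact: diameter_pow_ge0.
rewrite add0n eseries0; last first.
  by move=> i ni _; rewrite /diameter_pow /U ltnNge ni/= eqxx.
rewrite adde0; apply: (@le_trans _ _ (\sum_(0 <= k < n) (n%:R^-1 `^ s)%:E)).
  by apply: lee_sum => i _; exact: powU.
by rewrite sumEFin lee_fin sumr_const_nat subn0; move: ne; rewrite mulr_natl.
Qed.

Lemma hausdorff_dim_circle_le1 A : hausdorff_dim A <= 1%:E.
Proof.
apply/lee_addgt0Pr => eps e0; apply: ereal_inf_lbound; exists (1 + eps)%R => //.
by split; [rewrite addr_ge0// ltW | apply: hausdorff_measure_circle0; lra].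
Qed.

Local Close Scope ereal_scope.

Lemma sum_half_pow (c : R) n : \sum_(i < n) c / 2 ^+ i.+1 = c * (1 - (2 ^+ n)^-1).
Proof.
elim: n => [|n IH]; first by rewrite big_ord0 expr0 invr1 subrr mulr0.
by rewrite big_ord_recr/= IH !exprS; field; rewrite expf_neq0.
Qed.

(** Passing from s to (1 + s) / 2 makes the exponent positive even for s = 0. The sums do not grow,
    since the content is taken at scale 1 and diameters are at most 1. The [d i] are real numbers,
    with 0 in place of the diameter -oo of the empty set. *)
Lemma cover_of_null s A : 0 <= s < 1 -> hausdorff_measure s A = 0%E ->
  forall c, 0 < c -> exists (U : (set (circle R))^nat) (d : R^nat),
    [/\ forall i p q, U i p -> U i q -> mdist p q <= d i, forall i, 0 <= d i,
      A `<=` \bigcup_i U i & forall n, \sum_(i < n) d i `^ ((1 + s) / 2) <= c].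
Proof.
move=> /andP[s0 s1] H0 c c0.
have : (hausdorff_content s 1 A < c%:E)%E.
  apply: (@le_lt_trans _ _ 0%E); last by rewrite lte_fin.
  by rewrite -[leRHS]H0; apply: ereal_sup_ubound; exists 1 => //=.
move=> /ereal_inf_lt[_ [U [Ud AU] <-] Uc].
pose d i := if U i == set0 then 0 else fine (diameter (U i)).
have dE i : U i !=set0 -> diameter (U i) = (d i)%:E /\ 0 <= d i <= 1.
  move=> /[dup] Ui /set0P/negbTE Un; rewrite /d Un.
  have := diameter_ge0 Ui; have := Ud i.
  by case: (diameter (U i)) => //= r; rewrite !lee_fin => -> ->.
have d0 i : 0 <= d i.
  by have [h|/set0P/dE[_ /andP[]]//] := eqVneq (U i) set0; rewrite /d h eqxx.
exists U, d; split => //.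
  move=> i p q Up Uq; have [|dd _] := dE i; first by exists p.
  by rewrite -lee_fin -dd; apply: ereal_sup_ubound; exists p => //; exists q.
move=> n; rewrite -lee_fin (le_trans _ (ltW Uc))//.
apply: le_trans (nneseries_lim_ge n _); last by move=> *; exact: diameter_pow_ge0.
rewrite -sumEFin big_mkord; apply: lee_sum => i _; rewrite /diameter_pow.
case: ifPn => [/eqP Ui|/set0P/dE[-> /andP[_ d1]]].
  by rewrite /d Ui eqxx powR0 ?gt_eqF//; lra.
rewrite poweR_EFin lee_fin; have := d0 i; rewrite le_eqVlt => /predU1P[<-|d0'].
  by rewrite powR0 ?powR_ge0// gt_eqF//; lra.
by apply: ger_powR; rewrite ?d0' ?d1//; lra.
Qed.

Lemma hausdorff_dim_limsup_ge1 (m : nat -> nat) A : (forall k, (k <= m k)%N) ->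
    (forall x, (forall K, exists k j : nat, (K <= k)%N /\
        j%:R / grid_size R (m k) k <= x <= j%:R / grid_size R (m k) k + arc_length R (m k) k) ->
      A (\pi_(circle R)%qT x)) ->
  (1%:E <= hausdorff_dim A)%E.
Proof.
move=> mk Ax; apply: le_ereal_inf_tmp => _ [s [s0 H0] <-].
rewrite lee_fin leNgt; apply/negP => s1.
pose t := (1 + s) / 2; have t0 : 0 < t by rewrite /t; lra.
have t1 : t < 1 by rewrite /t; lra.
(* [2 * c] is the bound that [light] asks of [0, 1/2]: one half pays for the cover, the other for
   the enlargement of the diameters. *)
pose c : R := (2^-1 / 16) `^ t / 2.
have c0 : 0 < c by rewrite divr_gt0// powR_gt0.
have [|U [d [Ud d0 AU dc]]] := @cover_of_null s A _ H0 c c0; first by rewrite s0.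
pose W i := [set x : R | 0 <= x <= 2^-1 /\ U i (\pi_(circle R)%qT x)].
(* Enlarged diameters, so that points of the cover with diameter 0 are avoided too. *)
pose e i := (d i `^ t + c / 2 ^+ i.+1) `^ t^-1.
have q0 i : 0 < c / 2 ^+ i.+1 by rewrite divr_gt0// exprn_gt0.
have de0 i : 0 < d i `^ t + c / 2 ^+ i.+1 by rewrite ltr_wpDl// powR_ge0.
have e0 i : 0 < e i by rewrite powR_gt0.
have eE i : e i `^ t = d i `^ t + c / 2 ^+ i.+1.
  by rewrite -powRrM mulVf ?gt_eqF// powRr1// ltW.
have de i : d i <= e i.
  rewrite -[leLHS](powRr1 (d0 i)) -(mulfV (lt0r_neq0 t0)) powRrM.
  by apply: ge0_ler_powR; rewrite ?nnegrE ?powR_ge0 ?invr_ge0 ?(ltW t0) ?(ltW (de0 i))//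
    lerDl ltW.
have We i x y : W i x -> W i y -> `|x - y| <= e i.
  move=> [x01 Ux] [y01 Uy]; apply: le_trans (de i).
  by apply: le_trans (mdist_circle_half x01 y01) _; exact: Ud.
have light0 : light W e t 0 2^-1.
  move=> n; apply: (@le_trans _ _ (\sum_(i < n) (d i `^ t + c / 2 ^+ i.+1))).
    under [leRHS]eq_bigr => i _ do rewrite -eE.
    rewrite [leRHS](bigID (fun i : 'I_n => hits W i 0 2^-1))/=.
    by rewrite lerDl sumr_ge0// => i _; exact: powR_ge0.
  rewrite big_split/= sum_half_pow.
  have := dc n; rewrite -/t.
  have : c * (1 - (2 ^+ n)^-1) <= c.
    by rewrite ler_piMr ?(ltW c0)// gerBl invr_ge0 exprn_ge0.
  by have : (2^-1 / 16) `^ t = c + c; [rewrite /c; field | lra].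
have [x [x01 xW xE]] := light_limsup e0 We t0 t1 mk light0.
have [i _ Ui] := AU _ (Ax _ xE).
by apply: (xW i).
Qed.

End circle_dimension.

(** * Functions on the circle *)

Section modulus.
Variable R : realType.
Implicit Types z w : R[i].

Lemma normc_ge0 z : 0 <= normc z.
Proof. by case: z => a b; exact: sqrtr_ge0. Qed.

Lemma normcD z w : normc (z + w) <= normc z + normc w.
Proof. exact: le_normcD. Qed.

Lemma normcB z w : normc (z - w) <= normc z + normc w.
Proof. by rewrite (le_trans (normcD _ _))// (normcN w). Qed.

Lemma normc_distC z w : normc (z - w) = normc (w - z).
Proof. by rewrite -(opprB w z) (normcN (w - z)). Qed.

Lemma normc_le_ReIm z : normc z <= `|complex.Re z| + `|complex.Im z|.
Proof.
case: z => a b /=.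
rewrite -[leRHS]ger0_norm ?addr_ge0// -sqrtr_sqr ler_wsqrtr//.
rewrite -(real_normK (num_real a)) -(real_normK (num_real b)).
have := normr_ge0 a; have := normr_ge0 b.
by move: `|a| `|b| => x y; nra.
Qed.

Lemma Re_le_normc z : `|complex.Re z| <= normc z.
Proof. by case: z => a b /=; rewrite -sqrtr_sqr ler_wsqrtr// lerDl sqr_ge0. Qed.

Lemma Im_le_normc z : `|complex.Im z| <= normc z.
Proof. by case: z => a b /=; rewrite -sqrtr_sqr ler_wsqrtr// lerDr sqr_ge0. Qed.

Lemma ReD z w : complex.Re (z + w) = complex.Re z + complex.Re w.
Proof. by case: z w => ? ? []. Qed.

Lemma ImD z w : complex.Im (z + w) = complex.Im z + complex.Im w.
Proof. by case: z w => ? ? []. Qed.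

Lemma ReB z w : complex.Re (z - w) = complex.Re z - complex.Re w.
Proof. by case: z w => ? ? []. Qed.

Lemma ImB z w : complex.Im (z - w) = complex.Im z - complex.Im w.
Proof. by case: z w => ? ? []. Qed.

Lemma normc_sum (I : Type) (r : seq I) (P : pred I) (F : I -> R[i]) :
  normc (\sum_(i <- r | P i) F i) <= \sum_(i <- r | P i) normc (F i).
Proof.
elim/big_rec2: _ => [|i x y _ h]; first by rewrite normc0.
by rewrite (le_trans (normcD _ _))// lerD2l.
Qed.

Lemma normc_real (x : R) : normc x%:C%C = `|x|.
Proof. by rewrite /= expr0n addr0 sqrtr_sqr. Qed.

Lemma normcX z n : normc (z ^+ n) = normc z ^+ n.
Proof. by elim: n => [|n IH]; rewrite ?expr0 ?normc1// !exprS normcM IH. Qed.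

End modulus.

(** * Unimodular numbers and chord lengths *)

Section cis.
Variable R : realType.
Implicit Types a b d : R.

Definition cis a : R[i] := (cos a +i* sin a)%C.

Lemma cisD a b : cis (a + b) = cis a * cis b.
Proof.
by rewrite /cis cosD sinD; apply/eqP; rewrite eq_complex /= eqxx/= addrC.
Qed.

Lemma cis0 : cis 0 = 1.
Proof. by rewrite /cis cos0 sin0. Qed.

Lemma cisN a : cis (- a) = (cis a)^*%C.
Proof. by rewrite /cis cosN sinN. Qed.

Lemma cisMn a n : cis (a * n%:R) = cis a ^+ n.
Proof.
elim: n => [|n IH]; first by rewrite mulr0 cis0 expr0.
by rewrite -natr1 mulrDr mulr1 cisD IH exprSr.
Qed.

Lemma normc_cis a : normc (cis a) = 1.
Proof. by rewrite /= cos2Dsin2 sqrtr1. Qed.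

Lemma lipschitz_sin a b : `|sin a - sin b| <= `|a - b|.
Proof.
wlog ab : a b / b <= a.
  move=> h; have [/h//|/ltW/h] := leP b a.
  by rewrite distrC [`|b - a|]distrC.
have [|c _ ->] := @MVT_segment R sin cos b a ab.
  exact/continuous_subspaceT/continuous_sin.
by rewrite normrM ler_piMl// ler_norml cos_geN1 cos_le1.
Qed.

Lemma lipschitz_cos a b : `|cos a - cos b| <= `|a - b|.
Proof.
have := lipschitz_sin (a + pi / 2) (b + pi / 2).
by rewrite !sinDpihalf; have -> : a + pi / 2 - (b + pi / 2) = a - b by ring.
Qed.

Lemma lipschitz_cis a b : normc (cis a - cis b) <= 2 * `|a - b|.
Proof.
rewrite (le_trans (normc_le_ReIm _))// mulr_natl mulr2n lerD//.
  exact: lipschitz_cos.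
exact: lipschitz_sin.
Qed.

Lemma cos_ge1B a : 1 - `|a| <= cos a.
Proof.
by have := lipschitz_cos 0 a; rewrite cos0 sub0r normrN ler_norml; lra.
Qed.

(** Up to 1 / 2 the derivative cos is at least 1 / 2; beyond, monotonicity gives sin a > 1 / 4, and
    a / 8 < 1 / 4 because pi / 2 < 2. *)
Lemma sin_ge_linear a : 0 <= a <= pi / 2 -> a / 8 <= sin a.
Proof.
move=> /andP[a0 a2]; have p2 := @pihalf_lt2 R; have p1 := @pihalf_ge1 R.
have small b : 0 <= b <= 1 / 2 -> b / 2 <= sin b.
  move=> /andP[b0 b2]; have [|c cb] := @MVT_segment R sin cos 0 b b0.
      exact/continuous_subspaceT/continuous_sin.
  rewrite sin0 !subr0 => ->; move: cb; rewrite in_itv/= => /andP[c0 cb].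
  by have := cos_ge1B c; rewrite ger0_norm//; nra.
have [a1|a1] := leP a (1 / 2); first by have := small a; rewrite a0 a1 => /(_ isT); lra.
have : sin (1 / 2) < sin a.
  by rewrite ltr_sin// in_itv/=; lra.
by have := small (1 / 2); rewrite lexx => /(_ _); lra.
Qed.

Lemma normc_cisB1 a : normc (cis (2 * a) - 1) = 2 * `|sin a|.
Proof.
rewrite /cis mulrC -[a * 2]/(a * 2%:R) mulr_natr cos_mulr2n sin_mulr2n.
rewrite /= subr0.
have -> : (cos a ^+ 2 *+ 2 - 1 - 1) ^+ 2 + (cos a * sin a *+ 2) ^+ 2 =
    (2 * sin a) ^+ 2.
  (* The two sides differ by a multiple of cos ^ 2 + sin ^ 2 - 1; with this multiple written out,
     the identity is polynomial. *)
  rewrite [LHS](_ : _ =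
    (2 * sin a) ^+ 2 + 4 * (cos a ^+ 2 - 1) * (cos a ^+ 2 + sin a ^+ 2 - 1)).
    by rewrite cos2Dsin2 subrr mulr0 addr0.
  by ring.
by rewrite sqrtr_sqr normrM ger0_norm.
Qed.

Lemma normc_cisB1_ge d : `|d| <= 1 / 2 -> `|d| / 2 <= normc (cis (2 * pi * d) - 1).
Proof.
move=> d2; rewrite -mulrA normc_cisB1.
have -> : `|sin (pi * d)| = `|sin (pi * `|d|)|.
  by have [//|_] := ger0P d; rewrite mulrN sinN normrN.
have p0 := @pi_ge2 R; have d0 := normr_ge0 d.
have := @sin_ge_linear (pi * `|d|); have := ler_norm (sin (pi * `|d|)).
set s := sin _ => h1 h2.
have : pi * `|d| / 8 <= s by apply: h2; nra.
by nra.
Qed.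

End cis.

Section circle_functions.
Variable R : realType.
Implicit Types (p q : circle R) (u v : circle R -> R[i]) (k l : int).
Local Notation toC := (\pi_(circle R)%qT).

Lemma circle_exp_cis k (t : R) : circle_exp k (toC t) = cis (2 * pi * k%:~R * t).
Proof. exact: circle_exp_pi. Qed.

Lemma circle_exp_repr k p : circle_exp k p = cis (2 * pi * k%:~R * repr p).
Proof. by []. Qed.

(** Periodicity is read off from the fact that [circle_exp m] lives on the quotient, where -1 and 0
    are the same point. *)
Lemma cisB_int (t : R) (m : int) : cis (2 * pi * (t - m%:~R)) = cis (2 * pi * t).
Proof.
rewrite mulrBr cisD -[RHS]mulr1; congr (_ * _).
have := circle_exp_cis m (- 1 : R).
have -> : toC (- 1 : R) = toC 0 by apply/eq_pi_circle; rewrite subr0 rpredN rpred1.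
by rewrite circle_exp_cis mulr0 cis0 mulrN1.
Qed.

Lemma circle_expD k l p : circle_exp (k + l) p = circle_exp k p * circle_exp l p.
Proof. by rewrite !circle_exp_repr -cisD intrD; congr cis; ring. Qed.

Lemma circle_expN k p : circle_exp (- k) p = (circle_exp k p)^*.
Proof. by rewrite -[RHS]/(conjc _) !circle_exp_repr -cisN intrN; congr cis; ring. Qed.

Lemma circle_exp0 p : circle_exp 0 p = 1.
Proof. by rewrite circle_exp_repr mulr0 mul0r cis0. Qed.

(* Inductive rather than defined, so that unification never unfolds it. *)
Variant ccont u : Prop := Ccont of continuous (u : circle R -> R[i]^o).

Lemma normC_normc (z : R[i]) : `|z| = (normc z)%:C%C.
Proof. by case: z. Qed.

Lemma ccontP u : ccont u <-> forall p (e : R), 0 < e ->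
  exists2 d, 0 < d & forall q, mdist p q < d -> normc (u p - u q) < e.
Proof.
split=> [[cu] p e e0|h]; last constructor=> p.
  have := cu p; move/(@cvgrPdist_lt _ R[i]^o) => /(_ e%:C%C).
  rewrite ltcR => /(_ e0) /nbhs_ballP[d /= d0 dB].
  exists d => // q pq; have := dB q; rewrite ballEmdist => /(_ pq).
  by rewrite /= normC_normc ltcR.
have FF : Filter (nbhs p) by exact: nbhs_filter.
(* Radii of neighbourhoods are elements of [R[i]]; a positive one has imaginary part 0. *)
apply/(@cvgrPdist_lt _ R[i]^o _ _ FF) => e; case: e => a b /=.
rewrite ltcE /= => /andP[/eqP-> a0]; have [d d0 dB] := h p a a0.
apply/nbhs_ballP; exists d => //= q; rewrite ballEmdist => /dB.
by rewrite /= normC_normc ltcR.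
Qed.

(** The quotient distance is an infimum, so points at distance below e / M have representatives with
    |x - y| < e / M, to which the bound on the line applies. *)
Lemma ccont_lipschitz u (L : R) :
  (forall x y, normc (u (toC x) - u (toC y)) <= L * `|x - y|) -> ccont u.
Proof.
move=> uL; apply/ccontP => p e e0; pose M := Num.max L 1.
have M0 : 0 < M by rewrite lt_max ltr01 orbT.
exists (e / M); first by rewrite divr_gt0.
move=> q; rewrite ltr_pdivlMr//.
have S0 : has_inf [set `|x - y| | x in [set x | toC x = p] & y in [set y | toC y = q]].
  split; last by exists 0 => _ [x _ [y _ <-]].
  by exists `|repr p - repr q|, (repr p); rewrite /= ?reprK//; exists (repr q); rewrite /= ?reprK.
move=> pq; have d0 : 0 < e / M - mdist p q by rewrite subr_gt0 ltr_pdivlMr.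
have [_ [x <- [y <- <-]] xy] := inf_adherent d0 S0.
have {}xy : `|x - y| < e / M.
  by apply: (lt_le_trans xy); rewrite -[inf _]/(mdist (toC x) (toC y)) subrKC.
rewrite (le_lt_trans (uL _ _))//; move: xy; rewrite ltr_pdivlMr//; apply: le_lt_trans.
by rewrite mulrC ler_wpM2l// le_max lexx.
Qed.

Lemma lipschitz_circle_exp k x y :
  normc (circle_exp k (toC x) - circle_exp k (toC y)) <=
  2 * `|2 * pi * k%:~R| * `|x - y|.
Proof.
rewrite !circle_exp_cis (le_trans (lipschitz_cis _ _))//.
by rewrite -mulrBr normrM mulrA.
Qed.

Lemma ccont_exp k : ccont (circle_exp k).
Proof. by apply: ccont_lipschitz => x y; exact: lipschitz_circle_exp. Qed.

Lemma ccontD u v : ccont u -> ccont v -> ccont (fun p => u p + v p).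
Proof. by move=> [cu] [cv]; constructor=> p; apply: (@continuousD R[i] R[i]^o); [exact: cu|exact: cv]. Qed.

Lemma ccontB u v : ccont u -> ccont v -> ccont (fun p => u p - v p).
Proof. by move=> [cu] [cv]; constructor=> p; apply: (@continuousB R[i] R[i]^o); [exact: cu|exact: cv]. Qed.

Lemma ccontM u v : ccont u -> ccont v -> ccont (fun p => u p * v p).
Proof. by move=> [cu] [cv]; constructor=> p; apply: (@continuousM R[i]); [exact: cu|exact: cv]. Qed.

Lemma ccont_cst c : ccont (fun=> c).
Proof. by constructor=> p; exact: cst_continuous. Qed.

Lemma ccont_sum (I : Type) (r : seq I) (F : I -> circle R -> R[i]) :
  (forall i, ccont (F i)) -> ccont (fun p => \sum_(i <- r) F i p).
Proof.
move=> cF; elim: r => [|i r IH].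
  by under eq_fun do rewrite big_nil; exact: ccont_cst.
by under eq_fun do rewrite big_cons; exact: ccontD.
Qed.

Lemma ccont_Re u : ccont u -> continuous (fun x : R => complex.Re (u (toC x))).
Proof.
move=> /ccontP cu x; apply/cvgrPdist_lt => e e0.
have [d d0 dB] := cu (toC x) e e0; near=> y.
have : `|x - y| < d by near: y; exact: cvgr_dist_lt.
move=> /(le_lt_trans (circle_dist_pi x y))/dB; apply: le_lt_trans.
by rewrite -ReB Re_le_normc.
Unshelve. all: by end_near. Qed.

Lemma ccont_Im u : ccont u -> continuous (fun x : R => complex.Im (u (toC x))).
Proof.
move=> /ccontP cu x; apply/cvgrPdist_lt => e e0.
have [d d0 dB] := cu (toC x) e e0; near=> y.
have : `|x - y| < d by near: y; exact: cvgr_dist_lt.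
move=> /(le_lt_trans (circle_dist_pi x y))/dB; apply: le_lt_trans.
by rewrite -ImB Im_le_normc.
Unshelve. all: by end_near. Qed.

Lemma ccont_fun (f : circle_cts R) : ccont f.
Proof. by constructor; exact: cts_fun. Qed.

Lemma ccont_exists u : ccont u -> exists f : circle_cts R, forall p, f p = u p.
Proof.
move=> [cu]; pose i := isContinuous.Build (circle R) R[i]^o u cu.
by exists (HB.pack_for (continuousType (circle R) R[i]^o) (u : circle R -> R[i]^o) i).
Qed.

End circle_functions.

(** * Fourier sums *)

Section unit_interval_integral.
Variable R : realType.
Implicit Types f g F : R -> R.
Local Notation I := `[0%R, 1%R]%classic.

Lemma continuous_integrable01 f : continuous f ->
  (@lebesgue_measure R).-integrable I (EFin \o f).
Proof.
move=> cf; apply: continuous_compact_integrable; first exact: segment_compact.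
exact: continuous_subspaceT.
Qed.

Lemma Rintegral_FTC01 f F : continuous f ->
    (forall x : R, is_derive x (1 : R) F (f x)) ->
  \int[lebesgue_measure]_(t in I) f t = F 1 - F 0.
Proof.
move=> cf dF; have cF : continuous F.
  by move=> x; apply: differentiable_continuous; apply/derivable1_diffP; have [] := dF x.
rewrite /Rintegral (@continuous_FTC2 _ f F 0 1)//.
- exact: continuous_subspaceT.
- split; first by move=> x _; have [] := dF x.
  + apply: cvg_at_right_filter; exact: cF.
  + apply: cvg_at_left_filter; exact: cF.
- by move=> x _; rewrite derive1E; have [] := dF x.
Qed.

Lemma is_derive_scaled (f : R -> R) (df a : R) (x : R) : a != 0 ->
  is_derive (a * x) (1 : R) f df ->
  is_derive x (1 : R) (fun t => a^-1 * f (a * t)) df.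
Proof.
move=> a0 d.
have d1 : is_derive x (1 : R) (fun t : R => a * t) (a *: 1) by exact: is_deriveZ.
have d2 := is_derive1_comp d d1.
have -> : df = a^-1 *: (df * (a *: 1)).
  by rewrite /GRing.scale/= mulr1 mulrCA mulVf// mulr1.
exact: is_deriveZ.
Qed.

Lemma continuous_scaled f (a : R) : continuous f -> continuous (fun t => f (a * t)).
Proof.
move=> cf x; apply: (@continuous_comp _ _ _ (fun t => a * t) f); last exact: cf.
exact: mulrl_continuous.
Qed.

Lemma Rintegral_cos01 (a : R) : a != 0 ->
  \int[lebesgue_measure]_(t in I) cos (a * t) = sin a / a.
Proof.
move=> a0; have d x := is_derive_scaled a0 (is_derive_sin (a * x)).
rewrite (Rintegral_FTC01 (continuous_scaled (@continuous_cos R)) d).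
by rewrite mulr1 mulr0 sin0 mulr0 subr0 mulrC.
Qed.

Lemma Rintegral_sin01 (a : R) : a != 0 ->
  \int[lebesgue_measure]_(t in I) sin (a * t) = (1 - cos a) / a.
Proof.
move=> a0.
have d x : is_derive x (1 : R) (fun t => a^-1 * - cos (a * t)) (sin (a * x)).
  apply: (@is_derive_scaled (fun t => - cos t)) => //.
  have h := is_derive_cos (a * x).
  rewrite [X in is_derive _ _ X](_ : _ = - cos); last exact/funext.
  by have := is_deriveN h; rewrite opprK.
rewrite (Rintegral_FTC01 (continuous_scaled (@continuous_sin R)) d).
by rewrite mulr1 mulr0 cos0; ring.
Qed.

End unit_interval_integral.

Section circle_integral_theory.
Variable R : realType.
Implicit Types (u v : circle R -> R[i]) (k l : int) (c : R[i]) (p x : circle R).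
Local Notation toC := (\pi_(circle R)%qT).
Local Notation I := `[0%R, 1%R]%classic.

Lemma circle_integralD u v : ccont u -> ccont v ->
  circle_integral (fun p => u p + v p) = circle_integral u + circle_integral v.
Proof.
move=> cu cv; rewrite /circle_integral.
under eq_Rintegral do rewrite ReD.
under [X in (_ +i* X)%C]eq_Rintegral do rewrite ImD.
have mI : measurable (I : set R) by exact: measurable_itv.
rewrite RintegralD//; [|exact: continuous_integrable01 (ccont_Re cu)
  |exact: continuous_integrable01 (ccont_Re cv)].
rewrite RintegralD//; [exact: continuous_integrable01 (ccont_Im cu)
  |exact: continuous_integrable01 (ccont_Im cv)].
Qed.

Lemma circle_integralZ c u : ccont u ->
  circle_integral (fun p => c * u p) = c * circle_integral u.
Proof.
move=> cu; have iR := continuous_integrable01 (ccont_Re cu).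
have iI := continuous_integrable01 (ccont_Im cu).
have mI : measurable (I : set R) by exact: measurable_itv.
case: c => a b; rewrite /circle_integral.
have ReE z : complex.Re ((a +i* b)%C * z) = a * complex.Re z - b * complex.Im z.
  by case: z.
have ImE z : complex.Im ((a +i* b)%C * z) = a * complex.Im z + b * complex.Re z.
  by case: z => x y /=; rewrite addrC.
have iZ (f : R -> R) d : (@lebesgue_measure R).-integrable I (EFin \o f) ->
    (@lebesgue_measure R).-integrable I (EFin \o (fun t => d * f t)).
  move=> fi; have -> : EFin \o (fun t => d * f t) = (fun t => d%:E * (EFin \o f) t)%E.
    by apply/funext => t; rewrite /= EFinM.
  exact: integrableZl.
under eq_Rintegral do rewrite ReE.
under [X in (_ +i* X)%C]eq_Rintegral do rewrite ImE.
rewrite RintegralB//; [|exact: iZ|exact: iZ].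
rewrite RintegralD//; [|exact: iZ|exact: iZ].
by rewrite !RintegralZl// [in LHS]addrC.
Qed.

Lemma circle_integral_exp k : circle_integral (circle_exp k) = (k == 0)%:R :> R[i].
Proof.
have [->|k0] := eqVneq k 0.
  rewrite /circle_integral; under eq_Rintegral do rewrite circle_exp0 /=.
  under [X in (_ +i* X)%C]eq_Rintegral do rewrite circle_exp0 /=.
  rewrite !Rintegral_cst/=; try exact: measurable_itv.
  by rewrite lebesgue_measure_itv/= lte01 oppr0 adde0 mulr1 mul0r.
have a0 : 2 * pi * k%:~R != 0 :> R.
  by rewrite !mulf_neq0// ?intr_eq0// gt_eqF// pi_gt0.
rewrite /circle_integral.
under eq_Rintegral do rewrite circle_exp_cis /=.
under [X in (_ +i* X)%C]eq_Rintegral do rewrite circle_exp_cis /=.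
rewrite Rintegral_cos01// Rintegral_sin01//.
(* The values of cos and sin at 2 pi k are those at 0, since 0 and 1 are the same point of the
   circle. *)
have := circle_exp_cis k (1 : R); have := circle_exp_cis k (0 : R).
have -> : toC (0 : R) = toC 1 by apply/eq_pi_circle; rewrite sub0r rpredN rpred1.
move=> ->; rewrite !mulr0 mulr1 cis0 => -[<- <-].
by rewrite subrr !mul0r.
Qed.

Lemma ccont_conj_exp u k : ccont u -> ccont (fun p => u p * (circle_exp k p)^*).
Proof.
move=> cu; have -> : (fun p => u p * (circle_exp k p)^*) =
    (fun p => u p * circle_exp (- k) p) by apply/funext => p; rewrite circle_expN.
exact: ccontM cu (ccont_exp _ _).
Qed.

Lemma fourier_coefD u v k : ccont u -> ccont v ->
  fourier_coef (fun p => u p + v p) k = fourier_coef u k + fourier_coef v k.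
Proof.
move=> cu cv; rewrite /fourier_coef -circle_integralD.
- by congr circle_integral; apply/funext => p; rewrite mulrDl.
- exact: ccont_conj_exp.
- exact: ccont_conj_exp.
Qed.

Lemma fourier_coefZ c u k : ccont u ->
  fourier_coef (fun p => c * u p) k = c * fourier_coef u k.
Proof.
move=> cu; rewrite /fourier_coef -circle_integralZ.
- by congr circle_integral; apply/funext => p; rewrite mulrA.
- exact: ccont_conj_exp.
Qed.

Lemma fourier_coef_exp k l : fourier_coef (circle_exp k) l = (k == l)%:R :> R[i].
Proof.
rewrite /fourier_coef -subr_eq0 -circle_integral_exp; congr circle_integral.
by apply/funext => p; rewrite -circle_expN -circle_expD.
Qed.

Lemma fourier_sumD n u v x : ccont u -> ccont v ->
  fourier_sum n (fun p => u p + v p) x = fourier_sum n u x + fourier_sum n v x.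
Proof.
move=> cu cv; rewrite /fourier_sum -big_split/=; apply: eq_bigr => j _.
by rewrite fourier_coefD// mulrDl.
Qed.

Lemma fourier_sumZ n c u x : ccont u ->
  fourier_sum n (fun p => c * u p) x = c * fourier_sum n u x.
Proof.
move=> cu; rewrite /fourier_sum mulr_sumr; apply: eq_bigr => j _.
by rewrite fourier_coefZ// mulrA.
Qed.

Lemma fourier_sumB n u v x : ccont u -> ccont v ->
  fourier_sum n (fun p => u p - v p) x = fourier_sum n u x - fourier_sum n v x.
Proof.
move=> cu cv.
have -> : (fun p => u p - v p) = (fun p => u p + (-1) * v p).
  by apply/funext => p; rewrite mulN1r.
rewrite fourier_sumD// ?fourier_sumZ// ?mulN1r//.
exact: ccontM (ccont_cst _) cv.
Qed.

Lemma fourier_sum_exp n k x :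
  fourier_sum n (circle_exp k) x = if (`|k| <= n)%N then circle_exp k x else 0.
Proof.
rewrite /fourier_sum; under eq_bigr do rewrite fourier_coef_exp.
case: ifPn => kn; last first.
  rewrite big_nat big1// => j /andP[_ jn].
  have [kE|_] := eqVneq k (j%:Z - n%:Z); last by rewrite mul0r.
  by move: kn; rewrite kE; move: jn; clear; lia.
have kE : k = (absz (k + n%:Z))%:Z - n%:Z by move: kn; clear; lia.
have kin : absz (k + n%:Z) \in index_iota 0 n.*2.+1.
  by rewrite mem_index_iota; move: kn; clear; lia.
rewrite (bigD1_seq _ kin (iota_uniq _ _))/= -kE eqxx mul1r big1 ?addr0// => j jk.
have [kj|_] := eqVneq k (j%:Z - n%:Z); last by rewrite mul0r.
by move: jk; rewrite kj subrK absz_nat eqxx.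
Qed.

End circle_integral_theory.

(** * Logarithmic bound for partial sums *)

Section dirichlet_kernel.
Variable R : realType.
Implicit Types (u v : circle R -> R[i]) (p x : circle R) (t y : R).
Local Notation toC := (\pi_(circle R)%qT).
Local Notation I := `[0%R, 1%R]%classic.

Lemma normc_geometric (w : R[i]) n : normc w = 1 ->
  normc (\sum_(j < n) w ^+ j) <= n%:R /\
  normc (w - 1) * normc (\sum_(j < n) w ^+ j) <= 2.
Proof.
move=> w1; split.
  apply: (le_trans (normc_sum _ _ _)).
  under eq_bigr do rewrite normcX w1 expr1n.
  by rewrite sumr_const card_ord.
rewrite -normcM -subrX1 (le_trans (normcB _ _))// normcX w1 expr1n normc1.
by rewrite -[2]/(1 + 1).
Qed.

(** Only an inequality, because the intervals may stick out of [0, 1]; it serves for the step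
    majorant of the Dirichlet kernel. *)
Lemma integral_step_le (T : Type) (s : seq T) (c a l : T -> R) :
  (forall i, 0 <= c i) -> (forall i, 0 <= l i) ->
  (\int[lebesgue_measure]_(t in I)
    (\sum_(i <- s) c i * \1_(`[a i, (a i + l i)%R]%classic : set R) t)%:E <=
   (\sum_(i <- s) c i * l i)%:E)%E.
Proof.
move=> c0 l0; have mI : measurable (I : set R) by exact: measurable_itv.
have mA i : measurable (`[a i, (a i + l i)%R]%classic : set R) by exact: measurable_itv.
under eq_integral do rewrite -sumEFin.
rewrite ge0_integral_sum//.
- rewrite -sumEFin; apply: lee_sum => i _.
  under eq_integral do rewrite EFinM.
  rewrite ge0_integralZl//=.
  + rewrite integral_indic//= EFinM; apply: lee_wpmul2l; first by rewrite lee_fin.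
    apply: (@le_trans _ _ (lebesgue_measure (`[a i, (a i + l i)%R]%classic : set R))).
      by rewrite le_measure// inE//; exact: measurableI.
    rewrite /= lebesgue_measure_itv/=; case: ifP => _; last by rewrite lee_fin.
    by rewrite -EFinB addrAC subrr add0r.
  + by apply/measurable_EFinP; apply: measurable_indic; exact: measurable_itv.
  + by rewrite lee_fin.
- move=> i; apply/measurable_EFinP; apply: measurable_funM; first exact: measurable_cst.
  by apply: measurable_indic; exact: mA.
- by move=> i t _; rewrite lee_fin mulr_ge0.
Qed.

(** The factor 2 comes from bounding the real and imaginary parts separately. *)
Lemma normc_circle_integral_le v (g : R -> R) (B : R) : ccont v ->
    measurable_fun (I : set R) g -> (forall t, I t -> normc (v (toC t)) <= g t) ->
    (\int[lebesgue_measure]_(t in I) (g t)%:E <= B%:E)%E ->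
  normc (circle_integral v) <= 2 * B.
Proof.
move=> cv mg vg gB; have mI : measurable (I : set R) by exact: measurable_itv.
have key (f : R -> R) : continuous f -> (forall t, I t -> `|f t| <= g t) ->
    `|\int[lebesgue_measure]_(t in I) f t| <= B.
  move=> cf fg; have fi := continuous_integrable01 cf.
  have mf : measurable_fun (I : set R) (EFin \o f) by have /integrableP[] := fi.
  rewrite -lee_fin EFin_normr_Rintegral// (le_trans _ gB)//.
  apply: (le_trans (le_abse_integral _ _ _)) => //.
  apply: ge0_le_integral => //.
  - exact: measurableT_comp.
  - exact/measurable_EFinP.
apply: le_trans (normc_le_ReIm _) _.
rewrite (_ : 2 * B = B + B); last by rewrite mulr_natl mulr2n.
apply: lerD => /=.
  by apply: key; [exact: ccont_Re|move=> t /vg; exact/le_trans/Re_le_normc].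
by apply: key; [exact: ccont_Im|move=> t /vg; exact/le_trans/Im_le_normc].
Qed.

Lemma dyadic_scale (d : R) (J : nat) : 0 <= d <= 1 ->
  d <= (2 ^+ J)^-1 \/ exists2 j, (j < J)%N & (2 ^+ j.+1)^-1 < d <= (2 ^+ j)^-1.
Proof.
move=> /andP[d0 d1]; elim: J => [|J [dJ|[j jJ dj]]].
- by left; rewrite expr0 invr1.
- by have [?|?] := leP d (2 ^+ J.+1)^-1; [left|right; exists J => //; apply/andP].
- by right; exists j => //; exact: ltnW.
Qed.

Lemma circle_integral_sum (N : nat) (F : nat -> circle R -> R[i]) :
  (forall j, ccont (F j)) ->
  circle_integral (fun p => \sum_(j < N) F j p) = \sum_(j < N) circle_integral (F j).
Proof.
move=> cF; elim: N => [|N IH].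
  rewrite big_ord0 -[RHS](mul0r (circle_integral (circle_exp 0))).
  rewrite -circle_integralZ; last exact: ccont_exp.
  by congr circle_integral; apply/funext => p; rewrite big_ord0 mul0r.
rewrite big_ord_recr/= -IH -circle_integralD//; last exact: ccont_sum.
by congr circle_integral; apply/funext => p; rewrite big_ord_recr.
Qed.

Lemma fourier_sumE n u x : ccont u -> fourier_sum n u x =
  circle_integral (fun p => u p * \sum_(j < n.*2.+1)
    ((circle_exp (j%:Z - n%:Z) p)^* * circle_exp (j%:Z - n%:Z) x)).
Proof.
move=> cu; rewrite /fourier_sum big_mkord.
pose F j p := circle_exp (j%:Z - n%:Z) x * (u p * (circle_exp (j%:Z - n%:Z) p)^*).
have cF j : ccont (F j) by apply: ccontM; [exact: ccont_cst|exact: ccont_conj_exp].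
transitivity (\sum_(j < n.*2.+1) circle_integral (F j)).
  apply: eq_bigr => j _; rewrite circle_integralZ; last exact: ccont_conj_exp.
  by rewrite mulrC.
rewrite -circle_integral_sum//; congr circle_integral; apply/funext => p.
by rewrite mulr_sumr; apply: eq_bigr => j _; rewrite /F mulrC mulrA.
Qed.

(** Up to a unimodular factor D is a geometric sum of ratio w, hence |w - 1| |D| <= 2, and |w - 1|
    is at least half the distance from y - t to the nearest integer m. *)
Lemma normc_dirichlet n (y t : R) : let D := \sum_(j < n.*2.+1)
    ((circle_exp (j%:Z - n%:Z) (toC t))^* * circle_exp (j%:Z - n%:Z) (toC y)) in
  normc D <= n.*2.+1%:R /\
  forall m : int, `|y - t - m%:~R| <= 1 / 2 -> `|y - t - m%:~R| * normc D <= 4.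
Proof.
move=> D; pose w := cis (2 * pi * (y - t)).
have DE : D = cis (- (2 * pi * n%:R * (y - t))) * \sum_(j < n.*2.+1) w ^+ j.
  rewrite mulr_sumr; apply: eq_bigr => j _.
  rewrite -circle_expN !circle_exp_cis -cisMn -!cisD; congr cis.
  by rewrite rmorphN rmorphB/=; ring.
have nD : normc D = normc (\sum_(j < n.*2.+1) w ^+ j).
  by rewrite DE normcM normc_cis mul1r.
have [h1 h2] := normc_geometric n.*2.+1 (normc_cis (2 * pi * (y - t))).
rewrite nD; split => // m hm.
have wE : w = cis (2 * pi * (y - t - m%:~R)) by rewrite cisB_int.
have := normc_cisB1_ge hm; rewrite -wE; move: h2; rewrite -/w.
set a := normc (w - 1); set b := normc (\sum_(_ < _) _); set d := `|_|.
have : 0 <= b by exact: normc_ge0.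
by clear; nra.
Qed.

(** A majorant 8 B 2 ^ j on an interval of length 2 * 2 ^ -j has mass 16 B whatever the scale, so
    the logarithm is the number J + 1 of scales. The constant is 96 = 2 * 3 * 16, for two components
    and three translates. *)
Lemma normc_fourier_sum_le n J u x (B : R) : ccont u -> 0 <= B ->
    (forall p, normc (u p) <= B) -> (n.*2.+1 <= 2 ^ J)%N ->
  normc (fourier_sum n u x) <= 96 * B * J.+1%:R.
Proof.
move=> cu B0 uB nJ.
pose y := repr x - (Num.floor (repr x))%:~R.
have [y0 y1] : 0 <= y /\ y < 1.
  by have := floor_itv (repr x); rewrite /y intrD; lra.
have xy : toC y = x.
  rewrite -[RHS]reprK; apply/eq_pi_circle.
  by rewrite /y addrAC subrr add0r rpredN intr_int.
(* The Dirichlet kernel is dominated by 8 * 2 ^ j at distance at most 2 ^ -j from x,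
   and the three values of m account for the translates x - 1, x, x + 1 in R. *)
pose s := [seq (j, m) | j <- iota 0 J.+1, m <- iota 0 3].
pose c (i : nat * nat) : R := 8 * B * 2 ^+ i.1.
pose a (i : nat * nat) : R := y - i.2%:R + 1 - (2 ^+ i.1)^-1.
pose l (i : nat * nat) : R := 2 * (2 ^+ i.1)^-1.
have p0 j : 0 < 2 ^+ j :> R by rewrite exprn_gt0.
have c0 i : 0 <= c i by rewrite !mulr_ge0// ltW.
have l0 i : 0 <= l i by rewrite mulr_ge0// invr_ge0 ltW.
pose g t : R := \sum_(i <- s) c i * \1_(`[a i, (a i + l i)%R]%classic : set R) t.
have -> : 96 * B * J.+1%:R = 2 * \sum_(i <- s) c i * l i.
  rewrite (eq_bigr (fun=> 16 * B)); last first.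
    by move=> i _; rewrite /c /l; field; rewrite gt_eqF.
  rewrite big_const_seq count_predT size_allpairs !size_iota iter_addr_0.
  by rewrite -[_ *+ (J.+1 * 3)]mulr_natr natrM; ring.
rewrite fourier_sumE//; apply: (@normc_circle_integral_le _ g).
- apply: ccontM => //; pose F (j : nat) p :=
    (circle_exp (j%:Z - n%:Z) p)^* * circle_exp (j%:Z - n%:Z) x.
  apply: (@ccont_sum _ _ _ (fun j : 'I__ => F j)) => j.
  have -> : F j = fun p => circle_exp (- (j%:Z - n%:Z)) p * circle_exp (j%:Z - n%:Z) x.
    by apply/funext => p; rewrite /F -circle_expN.
  exact: ccontM (ccont_exp _ _) (ccont_cst _).
- apply: measurable_sum => i; apply: measurable_funM; first exact: measurable_cst.
  by apply: measurable_indic; exact: measurable_itv.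
- move=> t; rewrite /= in_itv/= => /andP[t0 t1].
  rewrite normcM -xy; have [h1 h2] := normc_dirichlet n y t.
  set D := \sum_(j < _) _ in h1 h2 *.
  suff [i is_ [tA cD]] : exists2 i, i \in s &
      `[a i, (a i + l i)%R]%classic t /\ normc D <= 8 * 2 ^+ i.1.
    apply: (@le_trans _ _ (c i)).
      rewrite /c [8 * B]mulrC -mulrA; apply: ler_pM => //; exact: normc_ge0.
    rewrite /g (big_rem i is_)/= indicE mem_set// mulr1 lerDl sumr_ge0// => k _.
    by rewrite mulr_ge0.
  (* As y - t lies in [-1, 1], an integer nearest to it is -1, 0 or 1; it is stored as m - 1. *)
  have [m m3 md] : exists2 m : nat, (m < 3)%N & `|y - t - (m%:Z - 1)%:~R| <= 1 / 2.
    have [yt|yt] := ltP (1 / 2) (y - t).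
      by exists 2%N => //; rewrite ler_norml; lra.
    have [yt'|yt'] := ltP (y - t) (- (1 / 2)).
      by exists 0%N => //; rewrite ler_norml; lra.
    by exists 1%N => //; rewrite ler_norml; lra.
  have := h2 _ md; set d := `|_| in md *; move=> dD.
  have dE : d = `|y - t - m%:R + 1|.
    by rewrite /d intrB; congr `|_|; rewrite opprB addrA [in RHS]addrAC.
  have tA j : d <= (2 ^+ j)^-1 -> `[a (j, m), (a (j, m) + l (j, m))%R]%classic t.
    rewrite dE ler_norml /= in_itv/= /a /l /= => /andP[].
    by move: (_^-1) => q h h'; apply/andP; split; lra.
  have js j : (j <= J)%N -> (j, m) \in s.
    by move=> jJ; apply/allpairsP; exists (j, m); rewrite !mem_iota.
  have d1 : 0 <= d <= 1 by rewrite normr_ge0 (le_trans md)//; lra.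
  have [dJ|[j jJ /andP[jd dj]]] := dyadic_scale J d1.
    exists (J, m); first exact: js.
    split; first exact: tA.
    rewrite (le_trans h1)// (@le_trans _ _ (2 ^+ J))//.
      by rewrite -natrX ler_nat.
    by rewrite ler_peMl ?ler1n// ltW.
  exists (j, m); first by apply: js; exact: ltnW.
  split; first exact: tA.
  have D0 : 0 <= normc D by exact: normc_ge0.
  have : (2 ^+ j.+1)^-1 * normc D <= 4 by apply: le_trans dD; rewrite ler_wpM2r// ltW.
  by rewrite mulrC ler_pdivrMr// exprS mulrA -[4 * 2]natrM.
- exact: integral_step_le.
Qed.

(** 768 = 96 * 8. Since 2 n + 1 <= n ^ 2 for n >= 3, T ln 2 <= 2 ln n; with 1 / 2 <= ln 2 <= ln n
    this yields T + 2 <= 8 ln n. *)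
Lemma fourier_sum_log n u x (B : R) : (3 <= n)%N -> ccont u -> 0 <= B ->
    (forall p, normc (u p) <= B) ->
  normc (fourier_sum n u x) <= 768 * B * ln n%:R.
Proof.
move=> n3 cu B0 uB; pose T := trunc_log 2 n.*2.+1.
have T1 : (n.*2.+1 <= 2 ^ T.+1)%N by rewrite ltnW// trunc_log_ltn.
apply: (le_trans (normc_fourier_sum_le x cu B0 uB T1)).
have n0 : 0 < n%:R :> R by rewrite ltr0n (leq_trans _ n3).
have l2 : 1 / 2 <= ln (2 : R).
  have : ln (1 + - 2^-1 : R) <= - 2^-1 by apply: le_ln1Dx; lra.
  have -> : 1 + - 2^-1 = 2^-1 :> R by lra.
  by rewrite lnV ?posrE//; lra.
have ln2n : ln (2 : R) <= ln n%:R.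
  by rewrite ler_ln ?posrE// ler_nat ltnW.
have TL : T%:R * ln (2 : R) <= 2 * ln n%:R.
  rewrite !mulr_natl -!lnXn// ler_ln ?posrE ?exprn_gt0// -!natrX ler_nat.
  apply: (@leq_trans n.*2.+1); first exact: trunc_logP.
  rewrite expnS expn1; move: n3; clear.
  case: n => [|[|[|n]]] // _; rewrite -addnn; nia.
have T8 : T.+2%:R <= 8 * ln n%:R :> R.
  have -> : T.+2%:R = T%:R + 2 :> R by rewrite -natrD addn2.
  have : 0 <= T%:R :> R by exact: ler0n.
  move: TL l2 ln2n; clear; move: (T%:R : R) (ln n%:R : R) (ln 2 : R) => a b c.
  by nra.
have -> : 768 * B * ln n%:R = 96 * B * (8 * ln n%:R).
  by move: (ln n%:R) => b; ring.
by rewrite ler_wpM2l// mulr_ge0.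
Qed.

End dirichlet_kernel.

(** * Density of trigonometric polynomials *)

Section trigonometric_polynomials.
Variable R : realType.
Implicit Types (u v : circle R -> R[i]) (p q x : circle R) (t y : R) (c : R[i]).
Local Notation toC := (\pi_(circle R)%qT).

Definition trig_poly (s : seq (R[i] * int)) p : R[i] :=
  \sum_(i <- s) i.1 * circle_exp i.2 p.

Definition is_trig u := exists s, forall p, u p = trig_poly s p.

Lemma is_trig0 : is_trig (fun=> 0).
Proof. by exists [::] => p; rewrite /trig_poly big_nil. Qed.

Lemma is_trig_exp c (k : int) : is_trig (fun p => c * circle_exp k p).
Proof. by exists [:: (c, k)] => p; rewrite /trig_poly big_seq1. Qed.

Lemma is_trigD u v : is_trig u -> is_trig v -> is_trig (fun p => u p + v p).
Proof.
by move=> [s us] [r vr]; exists (s ++ r) => p; rewrite /trig_poly big_cat/= us vr.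
Qed.

Lemma is_trig_sum (T : Type) (s : seq T) (F : T -> circle R -> R[i]) :
  (forall i, is_trig (F i)) -> is_trig (fun p => \sum_(i <- s) F i p).
Proof.
move=> tF; elim: s => [|i s IH].
  by have [r rE] := is_trig0; exists r => p; rewrite big_nil -rE.
by have [r rE] := is_trigD (tF i) IH; exists r => p; rewrite big_cons -rE.
Qed.

Lemma ccont_trig_poly s : ccont (trig_poly s).
Proof.
apply: (@ccont_sum _ _ s (fun i p => i.1 * circle_exp i.2 p)) => i.
exact: ccontM (ccont_cst _) (ccont_exp _ _).
Qed.

Lemma fourier_sum_trig_poly n s x :
  fourier_sum n (trig_poly s) x =
  \sum_(i <- s | (`|i.2| <= n)%N) i.1 * circle_exp i.2 x.
Proof.
elim: s => [|[c k] s IH].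
  rewrite big_nil; have -> : trig_poly [::] = (fun p => 0 * circle_exp 0 p).
    by apply/funext => p; rewrite /trig_poly big_nil mul0r.
  by rewrite fourier_sumZ ?mul0r//; exact: ccont_exp.
have -> : trig_poly ((c, k) :: s) = (fun p => c * circle_exp k p + trig_poly s p).
  by apply/funext => p; rewrite /trig_poly big_cons.
rewrite fourier_sumD; [|exact: ccontM (ccont_cst _) (ccont_exp _ _)|exact: ccont_trig_poly].
rewrite fourier_sumZ ?fourier_sum_exp ?IH ?big_cons/=; last exact: ccont_exp.
by case: ifP => _; rewrite ?mulr0 ?add0r.
Qed.

Lemma fourier_sum_trig u : is_trig u ->
  exists N, forall n x, (N <= n)%N -> fourier_sum n u x = u x.
Proof.
move=> [s us]; exists (\max_(i <- s) `|i.2|)%N => n x sn.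
have -> : u = trig_poly s by exact/funext.
rewrite fourier_sum_trig_poly /trig_poly big_seq_cond [RHS]big_seq.
apply: eq_bigl => i; case: (boolP (i \in s)) => //= is_.
apply: (leq_trans _ sn).
exact: (@leq_bigmax_seq _ s xpredT (fun i => absz i.2) i is_ isT).
Qed.

Lemma circle_cts_bounded (f : circle_cts R) : exists2 B, 0 < B & forall p, normc (f p) <= B.
Proof.
have [z z0] := ccont_exists (@ccont_cst R 0).
have [_ [B fB]] := sup_norm_has_sup f z.
exists (Num.max B 1); first by rewrite lt_max ltr01 orbT.
move=> p; rewrite le_max; apply/orP; left; apply: fB.
by exists p => //; rewrite z0 subr0.
Qed.

Lemma circle_unif_continuous u e : ccont u -> 0 < e ->
  exists2 d, 0 < d & forall p q, mdist p q < d -> normc (u p - u q) < e.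
Proof.
move=> /ccontP cu e0; have e20 : 0 < e / 2 by rewrite divr_gt0.
have /compact_near_coveringP := @circle_compact R.
move=> /(_ R (0 : R)^'+ (fun d p => forall q, mdist p q < d -> normc (u p - u q) < e)).
case=> [p _|d /= d0 dP]; last first.
  have d20 : 0 < d / 2 by rewrite divr_gt0.
  exists (d / 2) => // p q; apply: (dP (d / 2)) => //=.
  by rewrite sub0r normrN ger0_norm ?ltW//; lra.
have [d d0 dB] := cu p _ e20.
have d20 : 0 < d / 2 by rewrite divr_gt0.
exists (ball p (d / 2), [set i | i < d / 2]) => /=.
  by split; [exact: nbhsx_ballx|exact: nbhs_right_lt].
move=> [p' i]; rewrite ballEmdist /= => -[pp' id] q p'q.
have h1 : normc (u p - u p') < e / 2 by apply: dB; lra.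
have h2 : normc (u p - u q) < e / 2.
  by apply: dB; have := metric_triangle p p' q; lra.
rewrite -(subrKA (u p)) (le_lt_trans (normcD _ _))// normc_distC; lra.
Qed.

(** For k nonzero this is a geometric sum whose ratio z is an M-th root of unity; z differs from 1
    because |z - 1| = 2 |sin (pi k / M)| and 0 < |k / M| < 1. *)
Lemma grid_orthogonality (M : nat) (k : int) y : (`|k| < M)%N ->
  \sum_(j < M) cis (2 * pi * k%:~R * (y - j%:R / M%:R)) = (M%:R * (k == 0)%:R : R[i]).
Proof.
move=> kM; have M0 : 0 < M%:R :> R by rewrite ltr0n (leq_ltn_trans _ kM).
have [->|k0] := eqVneq k 0.
  under eq_bigr do rewrite mulr0 mul0r cis0.
  by rewrite sumr_const card_ord mulr1.
rewrite mulr0; pose a := 2 * pi * k%:~R / M%:R : R; pose z := cis (- a).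
have -> : \sum_(j < M) cis (2 * pi * k%:~R * (y - j%:R / M%:R)) =
    cis (2 * pi * k%:~R * y) * \sum_(j < M) z ^+ j.
  rewrite mulr_sumr; apply: eq_bigr => j _.
  by rewrite /z -cisMn -cisD; congr cis; rewrite /a; ring.
have zM : z ^+ M = 1.
  have := circle_exp_cis (- k) (1 : R); have := circle_exp_cis (- k) (0 : R).
  have -> : toC (0 : R) = toC 1 by apply/eq_pi_circle; rewrite sub0r rpredN rpred1.
  move=> ->; rewrite mulr0 cis0 mulr1 => ->; rewrite /z -cisMn; congr cis.
  by rewrite /a intrN; field; rewrite gt_eqF.
suff z1 : z - 1 != 0.
  have := subrX1 z M; rewrite zM subrr => /esym/eqP; rewrite mulf_eq0 (negbTE z1)/=.
  by move=> /eqP->; rewrite mulr0.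
apply/eqP => /(congr1 (@normc R)); rewrite normc0.
have -> : z = cis (2 * (- (pi * k%:~R / M%:R))) by congr cis; rewrite /a; ring.
rewrite normc_cisB1 sinN normrN => /eqP; rewrite mulf_eq0 (gt_eqF (ltr0Sn _ 1))/= normr_eq0.
have key (b : R) : 0 < b < 1 -> sin (pi * b) != 0.
  move=> /andP[b0 b1]; rewrite gt_eqF// sin_gt0_pi// mulr_gt0 ?pi_gt0//=.
  by rewrite gtr_pMr ?pi_gt0.
rewrite -mulrA; set b := _ / _.
have b01 : 0 < `|b| < 1.
  rewrite normr_gt0 mulf_neq0 ?intr_eq0// ?invr_eq0 ?gt_eqF//= normrM normfV.
  rewrite (gtr0_norm M0) ltr_pdivrMr// mul1r -intr_norm -[M%:R]/((M%:Z)%:~R) ltr_int.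
  by rewrite -abszE ltz_nat.
have [bge0|blt0] := ger0P b.
  by apply/negP; apply: key; rewrite -[b]ger0_norm.
rewrite -[b]opprK mulrN sinN oppr_eq0; apply/negP; apply: key.
by rewrite -[- b]ltr0_norm.
Qed.

(* Weights of the discrete Fejer operator on the grid {j / M}: the Fejer kernel is a
   square, and multiplying its square root by [e_1 - 1] telescopes it. *)
Definition fejer_weight (M : nat) (y : R) (j : nat) : R :=
  normc (\sum_(a < M) cis (2 * pi * (y - j%:R / M%:R)) ^+ a) ^+ 2 / M%:R ^+ 2.

Lemma fejer_weight_ge0 M y j : 0 <= fejer_weight M y j.
Proof. by rewrite divr_ge0// sqr_ge0. Qed.

Lemma fejer_weightE M y j : (fejer_weight M y j)%:C%C =
  (M%:R ^+ 2)^-1 * \sum_(a < M) \sum_(b < M)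
    cis (2 * pi * (a%:Z - b%:Z)%:~R * (y - j%:R / M%:R)).
Proof.
have sqE (z : R[i]) : (normc z ^+ 2)%:C%C = z * z^*.
  by rewrite -sqr_normc normC_normc rmorphXn.
rewrite /fejer_weight rmorphM/= sqE mulrC; congr (_ * _).
  by rewrite fmorphV rmorphXn/= rmorph_nat.
rewrite rmorph_sum/= mulr_suml; apply: eq_bigr => a _.
rewrite mulr_sumr; apply: eq_bigr => b _.
rewrite -!cisMn -[X in _ * X]/(conjc _) -cisN -cisD; congr cis.
by rewrite intrB; ring.
Qed.

(** In the double sum over frequencies a - b, all below M in absolute value, only the M diagonal
    terms survive summation over the grid. *)
Lemma sum_fejer_weight M y : (0 < M)%N -> \sum_(j < M) fejer_weight M y j = 1.
Proof.
move=> M0; have M0' : M%:R != 0 :> R[i] by rewrite pnatr_eq0 -lt0n.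
suff : (\sum_(j < M) fejer_weight M y j)%:C%C = 1 :> R[i] by case.
rewrite rmorph_sum/=; under eq_bigr do rewrite fejer_weightE.
rewrite -mulr_sumr exchange_big/=.
rewrite (eq_bigr (fun=> M%:R)) ?sumr_const ?card_ord.
  by rewrite -[M%:R *+ M]mulr_natr -expr2 mulVf// expf_neq0.
move=> a _; rewrite exchange_big/= (bigD1 a)//= subrr grid_orthogonality//.
rewrite eqxx mulr1 big1 ?addr0// => b ba; rewrite grid_orthogonality.
  by rewrite subr_eq0 eqz_nat eq_sym (_ : (b == a :> nat) = false) ?mulr0//; exact: negbTE.
by have := ltn_ord a; have := ltn_ord b; clear; lia.
Qed.

Lemma fejer_weight_moment M y j : (0 < M)%N ->
  fejer_weight M y j * normc (cis (2 * pi * (y - j%:R / M%:R)) - 1) ^+ 2 <=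
  4 / M%:R ^+ 2.
Proof.
move=> M0; rewrite /fejer_weight mulrAC ler_pdivrMr ?exprn_gt0 ?ltr0n// divfK; last first.
  by rewrite expf_neq0// pnatr_eq0 -lt0n.
have [_] := normc_geometric M (normc_cis (2 * pi * (y - j%:R / M%:R))).
set a := normc (_ - 1); set b := normc _.
have : 0 <= a by exact: normc_ge0.
have : 0 <= b by exact: normc_ge0.
move=> b0 a0 ab; rewrite -exprMn mulrC -[4]/((2 * 2)%:R) natrM -expr2.
by rewrite ler_sqr ?nnegrE ?mulr_ge0.
Qed.

(** Interpolation by the discrete Fejer operator: the weights are nonnegative of sum 1, and their
    second moments add up to at most 4 / M, which makes grid points far from p negligible as in
    Chebyshev's inequality. *)
Lemma trig_dense u e : ccont u -> (exists2 B, 0 < B & forall p, normc (u p) <= B) ->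
  0 < e -> exists2 v, is_trig v & forall p, normc (u p - v p) <= e.
Proof.
move=> cu [B B0 uB] e0; have e20 : 0 < e / 2 by rewrite divr_gt0.
have [d d0 dP] := circle_unif_continuous cu e20.
(* The far points cost 8 B / d ^ 2 times 4 / M, and this M brings it below e / 2. *)
pose M := (Num.truncn (64 * B / (d ^+ 2 * e))).+1.
have M0 : 0 < M%:R :> R by rewrite ltr0n.
have MB : 64 * B < M%:R * (d ^+ 2 * e).
  rewrite -ltr_pdivrMr ?mulr_gt0 ?exprn_gt0//.
  have t0 : 0 <= 64 * B / (d ^+ 2 * e).
    by rewrite divr_ge0 ?mulr_ge0 ?exprn_ge0 ?(ltW B0) ?(ltW e0) ?(ltW d0).
  by have /andP[] := truncn_itv t0.
pose v p := \sum_(j < M) \sum_(a < M) \sum_(b < M)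
  (u (toC (j%:R / M%:R)) * ((M%:R ^+ 2)^-1 *
    cis (- (2 * pi * (a%:Z - b%:Z)%:~R * (j%:R / M%:R))))) *
  circle_exp (a%:Z - b%:Z) p.
have vE y : v (toC y) = \sum_(j < M) u (toC (j%:R / M%:R)) * (fejer_weight M y j)%:C%C.
  apply: eq_bigr => j _; rewrite fejer_weightE !mulr_sumr; apply: eq_bigr => a _.
  rewrite !mulr_sumr; apply: eq_bigr => b _; rewrite circle_exp_cis -!mulrA.
  by rewrite -cisD; congr (_ * (_ * cis _)); ring.
exists v.
  by do 3 (apply: is_trig_sum => ?); exact: is_trig_exp.
move=> p; pose y := repr p; have <- : toC y = p by rewrite /y reprK.
have -> : u (toC y) = \sum_(j < M) u (toC y) * (fejer_weight M y j)%:C%C.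
  rewrite -mulr_sumr -rmorph_sum/= sum_fejer_weight// ?mulr1//.
rewrite vE -sumrB; apply: le_trans (normc_sum _ _ _) _.
apply: (@le_trans _ _ (\sum_(j < M) (e / 2 * fejer_weight M y j +
    8 * B / d ^+ 2 * (4 / M%:R ^+ 2)))).
  apply: ler_sum => j _; rewrite -mulrBl normcM normc_real.
  rewrite (ger0_norm (fejer_weight_ge0 _ _ _)).
  set w := fejer_weight _ _ _; have w0 : 0 <= w by exact: fejer_weight_ge0.
  have := fejer_weight_moment y j (isT : (0 < M)%N); rewrite -/w.
  set z := normc (cis _ - 1) => wz.
  have K0 : 0 <= 8 * B / d ^+ 2 by rewrite divr_ge0 ?mulr_ge0 ?exprn_ge0 ?(ltW B0) ?(ltW d0).
  (* One bound for both cases: e / 2 by uniform continuity at distance below d, and otherwise 2 B,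
     where the chord satisfies z >= d / 2. *)
  suff h : normc (u (toC y) - u (toC (j%:R / M%:R))) <= e / 2 + 8 * B / d ^+ 2 * z ^+ 2.
    apply: le_trans (ler_wpM2r w0 h) _.
    rewrite mulrDl lerD2l -[_ * w]mulrA [z ^+ 2 * w]mulrC.
    exact: ler_wpM2l.
  have z20 : 0 <= 8 * B / d ^+ 2 * z ^+ 2 by rewrite mulr_ge0// sqr_ge0.
  have [near|far] := ltP (mdist (toC y) (toC (j%:R / M%:R))) d.
    by rewrite (le_trans (ltW (dP _ _ near)))// lerDl.
  have dz : d / 2 <= z.
    pose t := y - j%:R / M%:R; pose m := Num.floor (t + 1 / 2).
    have tm : `|t - m%:~R| <= 1 / 2.
      by have := floor_itv (t + 1 / 2); rewrite -/m intrD ler_norml; lra.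
    have -> : z = normc (cis (2 * pi * (t - m%:~R)) - 1). by rewrite cisB_int.
    apply: le_trans (normc_cisB1_ge tm); rewrite ler_pM2r ?invr_gt0//.
    apply: le_trans far _.
    have -> : t - m%:~R = (y - m%:~R) - j%:R / M%:R by rewrite /t addrAC.
    have -> : toC y = toC (y - m%:~R).
      by apply/eq_pi_circle; rewrite opprB addrCA subrr addr0 intr_int.
    exact: circle_dist_pi.
  have : 2 * B <= 8 * B / d ^+ 2 * z ^+ 2.
    rewrite mulrAC ler_pdivlMr ?exprn_gt0//.
    have dz2 : d ^+ 2 <= 4 * z ^+ 2.
      rewrite -[4]/((2 * 2)%:R) natrM -expr2 -exprMn ler_sqr ?nnegrE ?(ltW d0)//.
        by move: dz; clear; lra.
      by move: dz d0; clear; lra.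
    have := ler_wpM2l (ltW B0) dz2; clear.
    by move: (d ^+ 2) (z ^+ 2) => D Z; lra.
  have := normcB (u (toC y)) (u (toC (j%:R / M%:R))).
  have := uB (toC y); have := uB (toC (j%:R / M%:R)).
  move: (normc (u (toC y))) (normc (u (toC (j%:R / M%:R)))) (normc (_ - _)) e20.
  by clear => a b c; move: (_ * z ^+ 2) => k; lra.
rewrite big_split/= -mulr_sumr sum_fejer_weight// sumr_const card_ord mulr1.
rewrite -[(_ * _) *+ M]mulr_natr.
have -> : 8 * B / d ^+ 2 * (4 / M%:R ^+ 2) * M%:R = 32 * B / (M%:R * d ^+ 2).
  by field; rewrite !gt_eqF.
have : 32 * B / (M%:R * d ^+ 2) <= e / 2.
  rewrite ler_pdivrMr ?mulr_gt0 ?exprn_gt0//.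
  by move: MB; rewrite mulrA; move: (M%:R * d ^+ 2) => K; lra.
by lra.
Qed.

End trigonometric_polynomials.

(** * Polynomials with large partial sums *)

Section sine_sums.
Variable R : realType.
Implicit Types (c : nat -> R) (d t y : R).

Lemma abel_bound c K n : (forall k, `|c k| <= 1) ->
  `|\sum_(i < n) (c (K + i)%N - c (K + i).+1) / (K + i).+1%:R| <= 2 / K.+1%:R.
Proof.
move=> c1; case: n => [|n]; first by rewrite big_ord0 normr0 divr_ge0.
pose r (k : nat) : R := k.+1%:R^-1.
have r0 k : 0 <= r k by rewrite invr_ge0.
have rS k : r k.+1 <= r k by rewrite lef_pV2 ?posrE// ler_nat.
have cr k l : `|c k * r l| <= r l by rewrite normrM (ger0_norm (r0 l)) ler_piMl.
(* Summation by parts in inductive form: with the boundary term included, each step changes the sum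
   by at most r (K + n) - r (K + n + 1), and these bounds telescope. *)
suff h : `|\sum_(i < n.+1) (c (K + i)%N - c (K + i).+1) / (K + i).+1%:R +
    c (K + n).+1 * r (K + n)%N| <= 2 * r K - r (K + n)%N.
  have := ler_normB (\sum_(i < n.+1) (c (K + i)%N - c (K + i).+1) / (K + i).+1%:R +
    c (K + n).+1 * r (K + n)%N) (c (K + n).+1 * r (K + n)%N).
  rewrite addrK; have := cr (K + n).+1 (K + n)%N.
  by rewrite -/(r K); lra.
elim: n => [|n IH].
  rewrite big_ord1 addn0 mulrBl subrK (le_trans (cr _ _))//.
  by rewrite mulr2n mulrDl !mul1r addrK.
rewrite big_ord_recr/= addnS -/(r (K + n).+1).
have -> (S : R) : S + (c (K + n).+1 - c (K + n).+2) * r (K + n).+1 +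
    c (K + n).+2 * r (K + n).+1 = (S + c (K + n).+1 * r (K + n)%N) -
    c (K + n).+1 * (r (K + n)%N - r (K + n).+1) by ring.
apply: le_trans (ler_normB _ _) _.
have : `|c (K + n).+1 * (r (K + n)%N - r (K + n).+1)| <= r (K + n)%N - r (K + n).+1.
  by rewrite normrM [X in _ * X]ger0_norm ?subr_ge0// ler_piMl// subr_ge0.
by move: IH; lra.
Qed.

(** Cut at K, the integer part of 1 / d. Each head term is at most 2 pi d < 8 d, in all 8.
    Multiplied by 2 sin (pi d) >= d / 2, the tail becomes a sum of differences of cosines, at most 2
    / (K + 1) <= 2 d by [abel_bound]; so the tail is at most 4. *)
Lemma sin_sum_small d m : 0 < d <= 1 / 2 ->
  `|\sum_(k < m) sin (2 * pi * d * k.+1%:R) / k.+1%:R| <= 12.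
Proof.
move=> /andP[d0 d2]; have p4 : pi < 4 :> R by have := @pihalf_lt2 R; lra.
have p2 := @pi_ge2 R.
have head n : n%:R * d <= 1 ->
    `|\sum_(k < n) sin (2 * pi * d * k.+1%:R) / k.+1%:R| <= 8.
  move=> nd; apply: le_trans (ler_norm_sum _ _ _) _.
  apply: (@le_trans _ _ (\sum_(k < n) (8 * d))).
    apply: ler_sum => k _; rewrite normrM normfV (ger0_norm (ler0n _ k.+1)).
    rewrite ler_pdivrMr//; have := lipschitz_sin (2 * pi * d * k.+1%:R) 0.
    rewrite sin0 !subr0 => /le_trans; apply.
    rewrite ger0_norm ?mulr_ge0 ?(ltW d0)//; last by lra.
    by rewrite ler_wpM2r// ler_wpM2r ?(ltW d0)//; lra.
  rewrite sumr_const card_ord -[(_ * _) *+ n]mulr_natl mulrCA.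
  by move: nd; clear; move: (n%:R * d) => a; lra.
have B0 : 0 <= d^-1 by rewrite invr_ge0 ltW.
have := truncn_itv B0; set K := Num.truncn _ => /andP[K1 K2].
have Kd : K%:R * d <= 1 by rewrite -ler_pdivlMr// div1r.
have [mK|Km] := leqP m K.
  by rewrite (le_trans (head m _)) ?ler_nat// (le_trans _ Kd)// ler_wpM2r ?ler_nat// ltW.
rewrite -(subnKC (ltnW Km)) big_split_ord/=.
apply: le_trans (ler_normD _ _) _; rewrite -[12]/((8 + 4)%:R) natrD lerD ?head//.
pose c k : R := cos (pi * d * (2 * k%:R + 1)).
have s0 : d / 4 <= sin (pi * d).
  apply: le_trans (sin_ge_linear _); first by nra.
  by apply/andP; split; nra.
set S := \sum_(i < _) _.
have : 2 * sin (pi * d) * S = \sum_(i < m - K) (c (K + i)%N - c (K + i).+1) / (K + i).+1%:R.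
  rewrite mulr_sumr; apply: eq_bigr => i _; rewrite mulrA; congr (_ / _).
  set k := (K + i)%N; rewrite /c.
  have -> : pi * d * (2 * k%:R + 1) = 2 * pi * d * k.+1%:R - pi * d.
    by rewrite -[k.+1%:R]natr1; ring.
  have -> : pi * d * (2 * k.+1%:R + 1) = 2 * pi * d * k.+1%:R + pi * d by ring.
  by rewrite cosB cosD; ring.
move=> SE.
have c1 k : `|c k| <= 1 by rewrite ler_norml cos_geN1 cos_le1.
have := abel_bound K (m - K) c1; rewrite -SE.
have sp0 : 0 <= 2 * sin (pi * d) by move: s0 d0; clear; lra.
rewrite normrM (ger0_norm sp0).
have : 2 / K.+1%:R <= 2 * d.
  by rewrite ler_pM2l// -[leRHS]invrK lef_pV2 ?posrE ?invr_gt0// ltW.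
have := normr_ge0 S; move: s0 d0; clear.
move: `|S| (sin _) (2 / _) => x z w; nra.
Qed.

Lemma sin_sum_bound y m :
  `|\sum_(k < m) sin (2 * pi * (y * k.+1%:R)) / k.+1%:R| <= 12.
Proof.
pose n := Num.floor (y + 1 / 2); pose d := y - n%:~R.
have d2 : `|d| <= 1 / 2.
  by have := floor_itv (y + 1 / 2); rewrite /d -/n intrD ler_norml; lra.
have -> : \sum_(k < m) sin (2 * pi * (y * k.+1%:R)) / k.+1%:R =
    \sum_(k < m) sin (2 * pi * d * k.+1%:R) / k.+1%:R.
  apply: eq_bigr => k _; congr (_ / _).
  have := cisB_int (y * k.+1%:R) (n * k.+1%:Z) => -[_ <-]; congr sin.
  by rewrite /d intrM; ring.
have [d0|d0|d0] := ltgtP 0 d; last first.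
- rewrite big1 ?normr0// => k _.
  by rewrite -d0 mulr0 mul0r sin0 mul0r.
- have -> : \sum_(k < m) sin (2 * pi * d * k.+1%:R) / k.+1%:R =
    - \sum_(k < m) sin (2 * pi * (- d) * k.+1%:R) / k.+1%:R.
    by rewrite -sumrN; apply: eq_bigr => k _; rewrite mulrN !mulNr sinN mulNr opprK.
  rewrite normrN; apply: sin_sum_small; move: d2; rewrite ler_norml; lra.
- by apply: sin_sum_small; move: d2; rewrite ler_norml; lra.
Qed.

Lemma ln_le_harmonic m : ln m.+1%:R <= \sum_(k < m) k.+1%:R^-1 :> R.
Proof.
elim: m => [|m IH]; first by rewrite ln1 big_ord0.
rewrite big_ord_recr/=.
have -> : m.+2%:R = m.+1%:R * (1 + m.+1%:R^-1) :> R.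
  by rewrite mulrDr mulr1 mulfV// natr1.
rewrite lnM ?posrE// ?addr_gt0 ?invr_gt0// lerD// le_ln1Dx//.
by rewrite (lt_le_trans (ltrN10 R))// invr_ge0.
Qed.

End sine_sums.

Section test_polynomial.
Variable R : realType.
Implicit Types (t : R) (m N : nat).
Local Notation toC := (\pi_(circle R)%qT).

(* This is i e_(N m) sum_(1 <= k <= m) sin(2 pi k N x) / k; truncating at frequency N m
   keeps exactly the second list. *)
Definition test_poly m N : seq (R[i] * int) :=
  [seq (((2 * k.+1%:R)^-1)%:C%C, N%:Z * (m%:Z + k.+1%:Z)) | k <- index_iota 0 m] ++
  [seq (- ((2 * k.+1%:R)^-1)%:C%C, N%:Z * (m%:Z - k.+1%:Z)) | k <- index_iota 0 m].

Lemma test_poly_bound m N (p : circle R) : normc (trig_poly (test_poly m N) p) <= 12.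
Proof.
have <- : toC (repr p) = p by rewrite reprK.
set t := repr p; rewrite /trig_poly big_cat/= !big_map !big_mkord -big_split/=.
pose b := cis (2 * pi * (N%:R * m%:R * t)).
(* The terms of index k in the two lists combine into b (e ^ (i z) - e ^ (- i z)) / (2 (k + 1)),
   with |b| = 1. *)
rewrite (eq_bigr (fun k : 'I_m => b *
    (0 +i* (sin (2 * pi * (N%:R * t * k.+1%:R)) / k.+1%:R))%C)); last first.
  move=> k _; rewrite !circle_exp_cis.
  set z := 2 * pi * (N%:R * t * k.+1%:R).
  have -> : 2 * pi * (N%:Z * (m%:Z + k.+1%:Z))%:~R * t =
      2 * pi * (N%:R * m%:R * t) + z.
    by rewrite intrM intrD /z; ring.
  have -> : 2 * pi * (N%:Z * (m%:Z - k.+1%:Z))%:~R * t =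
      2 * pi * (N%:R * m%:R * t) - z.
    by rewrite intrM intrB /z; ring.
  rewrite !cisD -/b mulNr !mulrA ![_ * b]mulrC -!mulrA -mulrBr; congr (_ * _).
  rewrite cisN -mulrBr; apply/eqP; rewrite eq_complex /=.
  by apply/andP; split; apply/eqP; field.
rewrite -mulr_sumr normcM normc_cis mul1r.
have -> (f : 'I_m -> R) : \sum_(k < m) (0 +i* f k)%C = (0 +i* \sum_(k < m) f k)%C :> R[i].
  by elim/big_rec2: _ => // k u v _ ->; apply/eqP; rewrite eq_complex /= addr0 !eqxx.
by rewrite /= expr0n add0r sqrtr_sqr; exact: sin_sum_bound.
Qed.

(** After removal of a unimodular factor the kept terms have real parts cos / (2 (k + 1)). On the
    arc every phase is at most 2 pi / 16 <= 1 / 2 modulo 2 pi, so the cosines are at least 1 / 2 and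
    a quarter of the harmonic sum remains. *)
Lemma fourier_sum_test_poly_ge m N t (j : nat) : (0 < N)%N -> (0 < m)%N ->
    0 <= N%:R * t - j%:R <= (16 * m%:R)^-1 ->
  ln m%:R / 4 <= normc (fourier_sum (N * m) (trig_poly (test_poly m N)) (toC t)).
Proof.
move=> N0 m0 /andP[t0 t1]; rewrite fourier_sum_trig_poly big_cat/= !big_map/=.
rewrite big_pred0 ?add0r; last first.
  by move=> k; apply/negbTE; rewrite -ltnNge; move: N0; clear; nia.
rewrite big_mkord.
pose b := cis (2 * pi * (N%:R * m%:R * t)).
pose z (k : 'I_m) := 2 * pi * (N%:R * t * k.+1%:R).
rewrite (eq_big xpredT (fun k : 'I_m => - b * (((2 * k.+1%:R)^-1)%:C%C * cis (- z k)))).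
- rewrite -mulr_sumr normcM (normcN b) normc_cis mul1r.
  apply: le_trans (Re_le_normc _); apply: le_trans (ler_norm _).
  rewrite raddf_sum/=.
  have h : ln m%:R / 4 <= \sum_(i < m) i.+1%:R^-1 / 4 :> R.
    rewrite -mulr_suml ler_pM2r ?invr_gt0//; apply: le_trans (ln_le_harmonic _ m).
    by rewrite ler_ln ?posrE ?ltr0n// ler_nat.
  apply: le_trans h _; apply: ler_sum => k _; rewrite mul0r subr0 cosN invfM.
  suff : 1 / 2 <= cos (z k).
    have : 0 <= k.+1%:R^-1 :> R by rewrite invr_ge0.
    by move: (_^-1) (cos _) => x c; nra.
  have := cisB_int (N%:R * t * k.+1%:R) (j%:Z * k.+1%:Z) => -[<- _].
  set a := 2 * pi * _; have aE : a = 2 * pi * (N%:R * t - j%:R) * k.+1%:R.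
    by rewrite /a intrM; ring.
  have a0 : 0 <= a by rewrite aE !mulr_ge0// pi_ge0.
  have a1 : a <= 1 / 2.
    have p4 : pi < 4 :> R by have := @pihalf_lt2 R; lra.
    have km : (N%:R * t - j%:R) * k.+1%:R <= 16^-1.
      apply: (@le_trans _ _ ((16 * m%:R)^-1 * m%:R)).
        by apply: ler_pM => //; rewrite ler_nat.
      by rewrite invfM mulfVK// pnatr_eq0 -lt0n.
    have km0 : 0 <= (N%:R * t - j%:R) * k.+1%:R by rewrite mulr_ge0.
    rewrite aE -mulrA; have := @pi_ge0 R; move: km km0 p4; clear.
    by move: (_ * k.+1%:R) pi => x y; nra.
  by have := cos_ge1B a; rewrite ger0_norm//; move: a1; clear; lra.
- by move=> k; have := ltn_ord k; clear; nia.
- move=> k _; rewrite circle_exp_cis mulNr mulNr mulrCA; congr (- (_ * _)).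
  rewrite -cisD; congr cis.
  by rewrite intrM intrB /z; ring.
Qed.

End test_polynomial.

(** * Generic divergence *)

Section limsup.
Variable R : realType.

Lemma limn_esup_le (u : (\bar R)^nat) (l : \bar R) (N : nat) :
  (forall n, (N <= n)%N -> (u n <= l)%E) -> (limn_esup u <= l)%E.
Proof.
move=> ul; rewrite /limn_esup limf_esupE; apply: ge_ereal_inf.
exists (ereal_sup [set u x | x in [set n | (N <= n)%N]]).
  by exists [set n | (N <= n)%N] => //; exists N.
by apply: ge_ereal_sup => _ [n /= Nn <-]; exact: ul.
Qed.

Lemma limn_esup_ge (u : (\bar R)^nat) (l : \bar R) :
  (forall N, exists2 n, (N <= n)%N & (l <= u n)%E) -> (l <= limn_esup u)%E.
Proof.
move=> ul; rewrite /limn_esup limf_esupE; apply: le_ereal_inf_tmp => _ [V [N _ NV] <-].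
have [n Nn ln] := ul N; apply: (le_trans ln); apply: ereal_sup_ubound.
by exists n => //; exact: NV.
Qed.

Lemma ln_large (A : R) (K : nat) : exists2 m : nat, (K <= m)%N & A <= ln (m%:R : R).
Proof.
have := truncn_itv (expR_ge0 A); set T := Num.truncn _ => /andP[_ h].
exists (maxn K T.+1); first exact: leq_maxl.
rewrite -[leLHS]expRK ler_ln ?posrE ?expR_gt0 ?ltr0n ?leq_max ?orbT//.
by rewrite (le_trans (ltW h))// ler_nat leq_maxr.
Qed.

Lemma ln_ln_large (A : R) : exists N, forall n, (N <= n)%N ->
  [/\ (3 <= n)%N, 0 < ln (n%:R : R), 0 < ln (ln (n%:R : R)) & A <= ln (ln (n%:R : R))].
Proof.
have [N N3 NA] := ln_large (expR (Num.max 1 A)) 3; exists N => n Nn.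
have n3 : (3 <= n)%N := leq_trans N3 Nn.
have h : expR (Num.max 1 A) <= ln (n%:R : R).
  have N0 : (0 < N)%N by exact: leq_trans N3.
  have n0 : (0 < n)%N by exact: leq_trans n3.
  by rewrite (le_trans NA)// ler_ln ?posrE ?ltr0n ?ler_nat.
have l0 : 0 < ln (n%:R : R) by rewrite (lt_le_trans _ h)// expR_gt0.
have h2 : Num.max 1 A <= ln (ln (n%:R : R)).
  by rewrite -[leLHS]expRK ler_ln// posrE expR_gt0.
by split => //; [apply: lt_le_trans h2|apply: le_trans h2]; rewrite ?lt_max ?ltr01// le_max lexx orbT.
Qed.

(** Each summand takes half of c X: the power once X ^ (1 / (k + 1)) >= 2 / c, the constant once X
    >= 2 A / c. With X = ln n, the reduced exponent absorbs a small factor and a bounded error. *)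
Lemma powR_sublinear (k : nat) (c A : R) : 0 < c -> exists X0, forall X, X0 <= X ->
  X `^ (1 - k.+1%:R^-1) + A <= c * X.
Proof.
move=> c0; have c2 : 0 < 2 / c by rewrite divr_gt0.
exists (Num.max 1 (Num.max ((2 / c) `^ k.+1%:R) (2 * A / c))) => X.
rewrite !ge_max => /and3P[X1 Xc XA]; have X0 : 0 < X by rewrite (lt_le_trans ltr01).
have h : 2 / c <= X `^ k.+1%:R^-1.
  have -> : 2 / c = ((2 / c) `^ k.+1%:R) `^ k.+1%:R^-1.
    by rewrite -powRrM mulfV// powRr1// ltW.
  by apply: ge0_ler_powR; rewrite ?nnegrE ?powR_ge0 ?(ltW X0)// invr_ge0.
have XE : X `^ (1 - k.+1%:R^-1) * X `^ k.+1%:R^-1 = X.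
  by rewrite -powRD ?subrK ?powRr1 ?(ltW X0)// oner_eq0.
have := ler_wpM2l (powR_ge0 X (1 - k.+1%:R^-1)) h; rewrite XE.
rewrite mulrA ler_pdivrMr//; move: XA; rewrite ler_pdivrMr//.
by clear; move: (X `^ _) => Y; lra.
Qed.

End limsup.

Section divergence.
Variable R : realType.
Implicit Types (f g : circle_cts R) (x p : circle R) (t : R).
Local Notation toC := (\pi_(circle R)%qT).

Lemma normc_le_mdist f g p : normc (f p - g p) <= mdist f g.
Proof. by apply: ub_le_sup; [exact: (sup_norm_has_sup f g).2|exists p]. Qed.

Lemma mdist_le f g (e : R) : (forall p, normc (f p - g p) <= e) -> mdist f g <= e.
Proof.
by move=> h; apply: ge_sup; [exact: (sup_norm_has_sup f g).1|move=> _ [p _ <-]].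
Qed.

Let ratio f x n := (lne (normc (fourier_sum n f x))%:E / (ln (ln n%:R))%:E)%E.

(** From |S_n f| <= C log n the ratio is at most 1 + log C / log log n, or -oo where S_n f
    vanishes. *)
Lemma divergence_le1 f x : (limn_esup (ratio f x) <= 1%:E)%E.
Proof.
have [B B0 fB] := circle_cts_bounded f.
apply/lee_addgt0Pr => e e0; pose C := Num.max 1 (768 * B).
have C0 : 0 < C by rewrite lt_max ltr01.
have [N NP] := ln_ln_large (ln C / e); apply: (@limn_esup_le _ _ _ N) => n /NP[n3 l0 ll0 lC].
have sC : normc (fourier_sum n f x) <= C * ln n%:R.
  apply: le_trans (fourier_sum_log x n3 (ccont_fun f) (ltW B0) fB) _.
  by rewrite ler_wpM2r ?(ltW l0)// le_max lexx orbT.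
rewrite /ratio inver gt_eqF//.
have := normc_ge0 (fourier_sum n f x); rewrite le_eqVlt => /predU1P[<-|s0].
  by rewrite le0_lneNy// gt0_mulNye ?leNye// lte_fin invr_gt0.
rewrite lne_EFin// -EFinM -EFinD lee_fin ler_pdivrMr//.
apply: (@le_trans _ _ (ln C + ln (ln n%:R))).
  by rewrite -lnM ?posrE// ler_ln ?posrE ?mulr_gt0.
by move: lC; rewrite ler_pdivrMr//; clear; move: (ln (ln _)) (ln C) => a b; lra.
Qed.

(** At such n the ratio is at least 1 - 1 / (k + 1); k may be taken beyond 1 / e, and k <= n carries
    n to infinity. *)
Lemma divergence_ge1 f x :
  (forall K, exists k n : nat, [/\ (K <= k)%N, (k <= n)%N &
    ln n%:R `^ (1 - k.+1%:R^-1) <= normc (fourier_sum n f x)]) ->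
  (1%:E <= limn_esup (ratio f x))%E.
Proof.
move=> fx; apply/lee_addgt0Pr => e e0.
have {}e0 : 0 < e := e0.
rewrite -leeBlDr//; apply: limn_esup_ge => N; rewrite -EFinB.
have [M MP] := ln_ln_large (0 : R).
have t0 : 0 <= e^-1 by rewrite invr_ge0 ltW.
have := truncn_itv t0; set T := Num.truncn _ => /andP[_ hT].
have [k [n [Kk kn h]]] := fx (maxn N (maxn M T.+1)).
have [Nk Mk Tk] : [/\ (N <= k)%N, (M <= k)%N & (T.+1 <= k)%N].
  by move: Kk; rewrite !geq_max => /and3P[].
have [n3 l0 ll0 _] := MP n (leq_trans Mk kn).
exists n; first exact: leq_trans kn.
have s0 : 0 < normc (fourier_sum n f x) by apply: lt_le_trans h; exact: powR_gt0.
rewrite /ratio inver gt_eqF// lne_EFin// -EFinM lee_fin ler_pdivlMr//.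
apply: (@le_trans _ _ ((1 - k.+1%:R^-1) * ln (ln n%:R))).
  rewrite ler_wpM2r ?(ltW ll0)// lerD2l lerN2 -[leRHS]invrK.
  by rewrite lef_pV2 ?posrE ?invr_gt0// (le_trans (ltW hT))// ler_nat ltnW.
by rewrite -ln_powR ler_ln ?posrE// powR_gt0.
Qed.

(* Membership for all k forces divergence of order 1 on a limsup set of arcs. *)
Definition large_on_grid (k : nat) : set (circle_cts R) :=
  [set f | exists2 m : nat, (k <= m)%N & forall t (j : nat),
    j%:R / grid_size R m k <= t <= j%:R / grid_size R m k + arc_length R m k ->
    ln (m ^ k * m)%:R `^ (1 - k.+1%:R^-1) <=
      normc (fourier_sum (m ^ k * m) f (toC t))].

Lemma dim_divergence f : (forall k, large_on_grid k f) ->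
  hausdorff_dim (divergence_set 1 f) = 1%:E.
Proof.
move=> fk; apply/eqP; rewrite eq_le hausdorff_dim_circle_le1/=.
pose m k := s2val (cid2 (fk k)).
have mk k : (k <= m k)%N := s2valP (cid2 (fk k)).
have mP k := s2valP' (cid2 (fk k)); rewrite -/(m _) in mP.
apply: (@hausdorff_dim_limsup_ge1 _ m _ mk) => x xE.
apply/eqP; rewrite eq_le divergence_le1/=; apply: divergence_ge1 => K.
(* [K.+1] forces k >= 1, hence m k >= 1, so that the order (m k) ^ (k + 1) is at least k. *)
have [k [j [Kk xj]]] := xE K.+1; have km := mk k.
exists k, (m k ^ k * m k)%N; split; [exact: ltnW| |exact: mP xj].
have m0 : (0 < m k)%N by apply: leq_trans km; exact: leq_trans Kk.
by rewrite (leq_trans km)// leq_pmull// expn_gt0 m0.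
Qed.

(** Once n exceeds the degree of v, S_n v = v stays bounded while the perturbation contributes a
    multiple of log n. A margin 1 above the threshold is kept so that a whole ball around g
    qualifies. *)
Lemma dense_large_on_grid k f (e : R) : 0 < e ->
  exists2 g, mdist f g < e & (large_on_grid k)° g.
Proof.
move=> e0; have e4 : 0 < e / 4 by rewrite divr_gt0.
have [B B0 fB] := circle_cts_bounded f.
have fb : exists2 B, 0 < B & forall p, normc (f p) <= B by exists B.
have [v tv vf] := trig_dense (ccont_fun f) fb e4.
have [D vD] := fourier_sum_trig tv.
have vB p : normc (v p) <= B + e / 4.
  rewrite -[v p](subKr (f p)) (le_trans (normcB _ _))// lerD//.
(* The test polynomial is bounded by 12, so its multiple has norm at most e / 4. *)
pose eta := e / 48; have eta0 : 0 < eta by rewrite divr_gt0.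
(* Since ln n = (k + 1) ln m, the gain eta (ln m) / 4 equals c ln n. *)
pose c := eta / 4 / k.+1%:R; have c0 : 0 < c by rewrite !divr_gt0.
have [X0 X0P] := powR_sublinear k (B + e / 4 + 1) c0.
have [m mK mX] := ln_large X0 (maxn k (maxn D 3)).
have [km Dm m3] : [/\ (k <= m)%N, (D <= m)%N & (3 <= m)%N].
  by move: mK; rewrite !geq_max => /and3P[].
have m0 : (0 < m)%N by exact: leq_trans m3.
(* Kept opaque: unification would otherwise compute with unary powers. *)
have [N NE] : exists N, N = (m ^ k)%N by exists (m ^ k)%N.
have [n nE] : exists n, n = (N * m)%N by exists (N * m)%N.
have N0 : (0 < N)%N by rewrite NE expn_gt0 m0.
have mn : (m <= n)%N by rewrite nE leq_pmull.
have lnE : ln n%:R = k.+1%:R * ln m%:R :> R.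
  by rewrite nE NE -expnSr natrX lnXn ?ltr0n// mulr_natl.
have n3 : (3 <= n)%N := leq_trans m3 mn.
have ln0 : 0 < ln (n%:R : R) by rewrite ln_gt0// ltr1n (leq_trans _ n3).
have lm0 : 0 <= ln (m%:R : R) by rewrite ln_ge0// ler1n.
have big : ln (n%:R : R) `^ (1 - k.+1%:R^-1) + (B + e / 4 + 1) <= eta / 4 * ln m%:R.
  have -> : eta / 4 * ln m%:R = c * ln n%:R by rewrite /c lnE; field.
  by apply: X0P; rewrite lnE (le_trans mX)// ler_peMl// ler1n.
pose T := trig_poly (test_poly R m N).
have cT : ccont T by exact: ccont_trig_poly.
have cv : ccont v.
  have [s vs] := tv; have -> : v = trig_poly s by exact/funext.
  exact: ccont_trig_poly.
have cZ : ccont (fun p => eta%:C%C * T p) := ccontM (ccont_cst _) cT.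
have [g gE] := ccont_exists (ccontD cv cZ).
have gfun : (g : circle R -> R[i]) = (fun p => v p + eta%:C%C * T p) by exact/funext.
exists g.
  apply: (@le_lt_trans _ _ (e / 4 + e / 4)); last by lra.
  apply: mdist_le => p; rewrite gE opprD addrA (le_trans (normcB _ _))// lerD//.
  rewrite normcM normc_real ger0_norm ?(ltW eta0)//.
  have := test_poly_bound m N p; rewrite -/T.
  have := ler_wpM2l (ltW eta0) (test_poly_bound m N p).
  by rewrite /eta; lra.
have gn t j : j%:R / grid_size R m k <= t <= j%:R / grid_size R m k + arc_length R m k ->
    ln n%:R `^ (1 - k.+1%:R^-1) + 1 <= normc (fourier_sum n g (toC t)).
  rewrite /arc_length /grid_size -NE => /andP[t0 t1].
  have N0' : 0 < N%:R :> R by rewrite ltr0n.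
  have m0' : 0 < m%:R :> R by rewrite ltr0n.
  have tj : 0 <= N%:R * t - j%:R <= (16 * m%:R)^-1.
    have -> : N%:R * t - j%:R = N%:R * (t - j%:R / N%:R) by field; rewrite gt_eqF.
    rewrite mulr_ge0 ?subr_ge0 ?(ltW N0')//=.
    have -> : (16 * m%:R)^-1 = N%:R * (16 * m%:R * N%:R)^-1 :> R.
      by field; rewrite !gt_eqF.
    by rewrite ler_wpM2l ?(ltW N0')// lerBlDl.
  have := fourier_sum_test_poly_ge N0 m0 tj; rewrite -/T -nE.
  rewrite gfun fourier_sumD// fourier_sumZ// vD ?(leq_trans Dm)//.
  move=> /(ler_wpM2l (ltW eta0)).
  have := normcB (v (toC t) + eta%:C%C * fourier_sum n T (toC t)) (v (toC t)).
  rewrite addrAC subrr add0r normcM normc_real (ger0_norm (ltW eta0)).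
  have := vB (toC t); move: big; set w := v (toC t) + _; clear.
  set a := normc w; set b := normc (v _); set d := normc (fourier_sum _ _ _).
  set x := ln n%:R `^ _; set y := ln m%:R; move: a b d x y => a b d x y.
  by lra.
(* By [fourier_sum_log], a change of f by at most 1 / q moves S_n f by at most 1, the margin kept
   above. *)
have [q qE q0] : exists2 q : R, q = 768 * ln (n%:R : R) & 0 < q.
  by exists (768 * ln n%:R); [exact: erefl|exact: mulr_gt0 (ltr0Sn R 767) ln0].
apply/nbhs_ballP; exists q^-1; first by rewrite /= invr_gt0.
move=> g'; rewrite ballEmdist => /= gg'; exists m => // t j /gn h.
have := fourier_sum_log (toC t) n3 (ccontB (ccont_fun g) (ccont_fun g')).
move=> /(_ q^-1); rewrite invr_ge0 (ltW q0) => /(_ isT).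
move=> /(_ (fun p => le_trans (normc_le_mdist g g' p) (ltW gg'))).
rewrite mulrAC -qE mulfV ?gt_eqF// fourier_sumB; [|exact: ccont_fun..].
have := normcD (fourier_sum n g (toC t) - fourier_sum n g' (toC t)) (fourier_sum n g' (toC t)).
rewrite subrK -NE -nE; move: h; clear.
set a := normc (_ - _); set b := normc (fourier_sum n g' _); set d := normc _.
by set x := ln n%:R `^ _; move: a b d x => a b d x; lra.
Qed.

End divergence.

Theorem theorem1p3 (R : realType) :
  residual [set f : circle_cts R | hausdorff_dim (divergence_set 1 f) = 1%:E].
Proof.
exists (fun k => (large_on_grid k)°); split => [k|f fk].
  split; first exact: open_interior.
  move=> O [f Of] oO; have /nbhs_ballP[e /= e0 eO] : nbhs f O by exact: open_nbhs_nbhs.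
  have [g fg gk] := dense_large_on_grid k f e0.
  by exists g; split => //; apply: eO; rewrite ballEmdist.
by apply: dim_divergence => k; apply: interior_subset; exact: fk.
Qed.
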